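(* Let $f\in H^{1/2}(\partial\Omega)$, let $h_n=\nabla\cdot(\alpha_n\nabla(\eta f))\in H^{-1}(\Omega)$, and for each $n\in\mathbb{N}$ let $u_n^{\alpha_n}\in H^1_0(\Omega)$ be the solution of $$-\nabla\cdot(\alpha_n\nabla u_n^{\alpha_n})=h_n\ \text{in }\Omega,\qquad u_n^{\alpha_n}=0\ \text{on }\partial\Omega.$$ Let $u^\alpha\in H_0^1(\Omega)$ be the unique solution of $$-\nabla\cdot(\alpha\nabla u^\alpha)=h\ \text{in }\Omega,\qquad u^\alpha=0\ \text{on }\partial\Omega,\qquad h:=\nabla\cdot(\alpha\nabla(\eta f)).$$ Then, as $n\to\infty$, $u_n^{\alpha_n}\rightharpoonup u^\alpha$ weakly in $H_0^1(\Omega)$ and $\alpha_n\nabla u_n^{\alpha_n}\rightharpoonup\alpha\nabla u^\alpha$ weakly in $(L^2(\Omega))^N$. In addition, $$\int_\Omega\alpha_n|\nabla(u_n^{\alpha_n}+\eta f)|^2\,dx\longrightarrow\int_\Omega\alpha|\nabla(u^\alpha+\eta f)|^2\,dx.$$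
   Context: $\Omega\subset\mathbb{R}^N$ ($N=2,3$) is a bounded domain with Lipschitz boundary, $0<b<c<\infty$, and $L^\infty(\Omega,[b,c])$ is the set of functions in $L^\infty(\Omega)$ with values in $[b,c]$ a.e. Standing assumption on the conductivities: $\alpha_n,\alpha\in L^\infty(\Omega,[b,c])$ with $\alpha_n\to\alpha$ strongly in $L^1(\Omega)$ and $\alpha_n\rightharpoonup\alpha$ weakly$^\ast$ in $L^\infty(\Omega)$. $\gamma:H^1(\Omega)\to H^{1/2}(\partial\Omega)$ is the trace operator and $\eta:H^{1/2}(\partial\Omega)\to H^1(\Omega)$ is a fixed continuous linear right inverse of $\gamma$ (extension operator). *)

(* Defs.v *)
From HB Require Import structures.
From mathcomp Require Import all_boot all_order all_algebra.
From mathcomp Require Import all_classical all_reals all_analysis.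

Set Implicit Arguments.
Unset Strict Implicit.
Unset Printing Implicit Defensive.

Import Order.TTheory GRing.Theory Num.Theory.
Import numFieldNormedType.Exports.

Local Open Scope classical_set_scope.
Local Open Scope ring_scope.

Fact rV_display : measure_display. Proof. exact: default_measure_display. Qed.

(* The sigma-algebra generated by the coordinates, i.e., the Borel one. *)
Section measurable_rV.
Context (R : realType) (n : nat).

Let coors : 'I_n -> 'rV[R]_n -> measurableTypeR R := fun i x => x ord0 i.

Let rV_set0 : g_sigma_preimage coors set0.
Proof. exact: sigma_algebra0. Qed.

Let rV_setC A : g_sigma_preimage coors A -> g_sigma_preimage coors (~` A).
Proof. exact: sigma_algebraC. Qed.

Let rV_bigcup (F : _^nat) : (forall i, g_sigma_preimage coors (F i)) ->
  g_sigma_preimage coors (\bigcup_i (F i)).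
Proof. exact: sigma_algebra_bigcup. Qed.

HB.instance Definition _ := @isMeasurable.Build rV_display
  'rV[R]_n (g_sigma_preimage coors) rV_set0 rV_setC rV_bigcup.

Lemma measurable_coord (i : 'I_n) :
  measurable_fun [set: 'rV[R]_n] (fun x : 'rV[R]_n => x ord0 i : measurableTypeR R).
Proof.
move=> _ Y mY; rewrite setTI; apply: sub_sigma_algebra => /=.
rewrite -bigcup_seq/=; exists i => /=; first by rewrite mem_index_enum.
by exists Y => //; rewrite setTI.
Qed.

Lemma measurable_fun_rV d (T : measurableType d) (f : T -> 'rV[R]_n) :
  (forall i, measurable_fun [set: T] (fun x => f x ord0 i : measurableTypeR R)) ->
  measurable_fun [set: T] f.
Proof.
move=> mf _ A mA; rewrite setTI.
pose G := [set B : set 'rV[R]_n | measurable (f @^-1` B)].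
suff : G A by [].
move: A mA; apply: smallest_sub.
  split => [|B|F] /=; rewrite /G /=.
  - by rewrite preimage_set0.
  - by move=> mB; rewrite setTD -preimage_setC; exact: measurableC.
  - by move=> mF; rewrite preimage_bigcup; exact: bigcup_measurable.
rewrite -bigcup_seq => B [i _ [C mC <-]]; rewrite /G /= setTI.
by rewrite -[X in measurable X]setTI; exact: mf.
Qed.

End measurable_rV.

Section rV_cons.
Context (R : realType) (n : nat).

Definition rV_cons (p : measurableTypeR R * 'rV[R]_n) : 'rV[R]_n.+1 :=
  \row_j oapp (p.2 ord0) p.1 (unlift ord0 j).

Lemma measurable_rV_cons : measurable_fun [set: _] rV_cons.
Proof.
apply: measurable_fun_rV => i.
under eq_fun do rewrite mxE.
case: unliftP => [j _|_] /=; last exact: measurable_fst.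
exact: (measurableT_comp (measurable_coord j) measurable_snd).
Qed.

Let rV_uncons (w : 'rV[R]_n.+1) : measurableTypeR R * 'rV[R]_n :=
  (w ord0 ord0, \row_j w ord0 (lift ord0 j)).

Let rV_consK : cancel rV_cons rV_uncons.
Proof.
move=> [x v]; rewrite /rV_uncons /rV_cons !mxE unlift_none /=; congr pair.
by apply/rowP => j; rewrite !mxE liftK.
Qed.

Let measurable_rV_uncons : measurable_fun [set: _] rV_uncons.
Proof.
apply/measurable_fun_pairP; split; first exact: (@measurable_coord R n.+1 ord0).
apply: measurable_fun_rV => i; under eq_fun do rewrite mxE.
exact: (@measurable_coord R n.+1).
Qed.

Variable mu : {sigma_finite_measure set 'rV[R]_n -> \bar R}.

Definition cons_measure : set 'rV[R]_n.+1 -> \bar R :=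
  pushforward (@lebesgue_measure R \x mu)%E rV_cons.

Let cons_measure0 : cons_measure set0 = 0.
Proof. by rewrite /cons_measure /pushforward preimage_set0 measure0. Qed.

Let cons_measure_ge0 A : (0 <= cons_measure A)%E.
Proof. by apply: integral_ge0 => x _; exact: measure_ge0. Qed.

Let cons_measure_sigma_additive : semi_sigma_additive cons_measure.
Proof.
move=> F mF tF mUF; rewrite /cons_measure /pushforward preimage_bigcup.
apply: measure_semi_sigma_additive.
- by move=> k; rewrite -[X in measurable X]setTI; exact: measurable_rV_cons.
- apply/trivIsetP => /= i j _ _ ij; rewrite -preimage_setI.
  by move/trivIsetP : tF => /(_ _ _ _ _ ij) ->//; rewrite preimage_set0.
- rewrite -preimage_bigcup -[X in measurable X]setTI.
  exact: measurable_rV_cons.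
Qed.

HB.instance Definition _ := isMeasure.Build _ _ _ cons_measure
  cons_measure0 cons_measure_ge0 cons_measure_sigma_additive.

Let cons_measure_sigma_finite : sigma_finite setT cons_measure.
Proof.
have /sigma_finiteP[F [TF ndF Foo]] := sigma_finiteT (@lebesgue_measure R).
have /sigma_finiteP[G [TG ndG Goo]] := sigma_finiteT mu.
exists (fun k => rV_uncons @^-1` (F k `*` G k)).
  rewrite -preimage_bigcup (_ : \bigcup_k _ = setT) ?preimage_setT//.
  rewrite -setXTT TF TG predeqE => -[x y]; split.
    by move=> [k _ []/= ? ?]; split; exists k.
  move=> [/= [i _ Fix] [k _ Gky]]; exists (maxn i k) => //; split.
  - by move: x Fix; exact/subsetPset/ndF/leq_maxl.
  - by move: y Gky; exact/subsetPset/ndG/leq_maxr.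
move=> k; have [? ?] := Foo k; have [? ?] := Goo k; split.
  rewrite -[X in measurable X]setTI; apply: measurable_rV_uncons => //.
  exact: measurableX.
rewrite /cons_measure /pushforward -comp_preimage.
rewrite (_ : _ \o _ = id) ?preimage_id; last first.
  by apply/funext => p; exact: rV_consK.
by rewrite product_measure1E// lte_mul_pinfty// ge0_fin_numE.
Qed.

HB.instance Definition _ := Measure_isSigmaFinite.Build _ _ _ cons_measure
  cons_measure_sigma_finite.

End rV_cons.

(* The n-dimensional Lebesgue measure on Borel sets, as an iterated product. *)
Fixpoint leb (R : realType) (n : nat) :
    {sigma_finite_measure set 'rV[R]_n -> \bar R} :=
  match n with
  | 0 => \d_ (0 : 'rV[R]_0)
  | n'.+1 => cons_measure (leb R n')
  end.

Section euclidean.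
Context (R : realType) (n : nat).
Implicit Types (x y : 'rV[R]_n) (A : set 'rV[R]_n).

Definition edot x y : R := \sum_i x ord0 i * y ord0 i.

Definition enorm x : R := Num.sqrt (edot x x).

Definition ediam A : \bar R :=
  ereal_sup [set (enorm (p.1 - p.2))%:E | p in A `*` A].

End euclidean.

Section hausdorff_measure.
Context (R : realType) (n s : nat).
Implicit Types (delta : R) (A : set 'rV[R]_n).

(* alpha(s) / 2 ^ s, where alpha(s) is the volume of the unit ball of R^s *)
Definition hausdorff_cst : \bar R :=
  (leb R s [set x | enorm x <= 1]%R * (2^-1 ^+ s)%:E)%E.

Definition hausdorff_gauge delta A : \bar R :=
  if `[< A = set0 >] then 0%E
  else if (ediam A < delta%:E)%E then (hausdorff_cst * ediam A ^+ s)%E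
  else +oo%E.

(* Every set is measurable in [g_sigma_algebraType setT], hence [mu_ext] is
   here the infimum over all countable covers. *)
Definition hausdorff_delta delta A : \bar R :=
  @mu_ext _ (g_sigma_algebraType [set: set 'rV[R]_n]) R
    (hausdorff_gauge delta) A.

Definition hausdorff A : \bar R :=
  ereal_sup [set hausdorff_delta delta A | delta in [set delta | 0 < delta]].

Lemma hausdorff_gauge0 delta : hausdorff_gauge delta set0 = 0%E.
Proof. by rewrite /hausdorff_gauge asboolT. Qed.

Lemma hausdorff_gauge_ge0 delta A : (0 <= hausdorff_gauge delta A)%E.
Proof.
rewrite /hausdorff_gauge; case: asboolP => // /eqP/set0P[x Ax].
case: ifPn => // _; apply: mule_ge0.
  by apply: mule_ge0 => //; rewrite lee_fin exprn_ge0// invr_ge0.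
apply: expe_ge0; apply: ereal_sup_ubound; exists (x, x) => //=.
rewrite subrr /enorm (_ : edot _ _ = 0) ?sqrtr0//.
by rewrite /edot big1// => i _; rewrite mxE mul0r.
Qed.

Lemma hausdorff0 : hausdorff set0 = 0%E.
Proof.
apply/eqP; rewrite eq_le; apply/andP; split.
  apply: ge_ereal_sup => _ [delta _ <-]; rewrite /hausdorff_delta.
  by rewrite mu_ext0//; [exact: hausdorff_gauge0|exact: hausdorff_gauge_ge0].
apply: (@le_trans _ _ (hausdorff_delta 1 set0)).
  by apply: mu_ext_ge0; exact: hausdorff_gauge_ge0.
by apply: ereal_sup_ubound; exists 1 => //=.
Qed.

Lemma hausdorff_ge0 A : (0 <= hausdorff A)%E.
Proof.
apply: (@le_trans _ _ (hausdorff_delta 1 A)).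
  by apply: mu_ext_ge0; exact: hausdorff_gauge_ge0.
by apply: ereal_sup_ubound; exists 1 => //=.
Qed.

Lemma le_hausdorff : {homo hausdorff : A B / A `<=` B >-> (A <= B)%E}.
Proof.
move=> A B AB; apply: ge_ereal_sup => _ [delta d0 <-].
apply: (@le_trans _ _ (hausdorff_delta delta B)); first exact: le_mu_ext.
by apply: ereal_sup_ubound; exists delta.
Qed.

Lemma hausdorff_sigma_subadditive : sigma_subadditive hausdorff.
Proof.
move=> F; apply: ge_ereal_sup => _ [delta d0 <-].
apply: (le_trans (@mu_ext_sigma_subadditive _
  (g_sigma_algebraType [set: set 'rV[R]_n]) R _ (hausdorff_gauge_ge0 delta) F)).
apply: lee_nneseries => [k _ _|k _].
  by apply: mu_ext_ge0; exact: hausdorff_gauge_ge0.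
by apply: ereal_sup_ubound; exists delta.
Qed.

HB.instance Definition _ := isOuterMeasure.Build R 'rV[R]_n hausdorff
  hausdorff0 hausdorff_ge0 le_hausdorff hausdorff_sigma_subadditive.

End hausdorff_measure.

Section surface_measure.
Context (R : realType) (n : nat).

Let mu : {outer_measure set 'rV[R]_n -> \bar R} := @hausdorff R n n.-1.

(* R^n with the sigma-algebra of the Caratheodory-measurable sets of the
   (n - 1)-dimensional Hausdorff measure, which contains the Borel sets. *)
Definition surfaceType := caratheodory_type mu.

Definition surface : {measure set surfaceType -> \bar R} :=
  (mu : set (caratheodory_type mu) -> \bar R).

End surface_measure.

(* A normed space presented by representatives: [fnorm] is a seminorm on the
   linear subspace [fmem], and u, v in [fmem] denote the same element of the
   space iff [fnorm (u - v) = 0]. *)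
Record fspace (R : realType) := FSpace {
  fsort :> lmodType R ;
  fmem : set fsort ;
  fnorm : fsort -> R }.

Section functional_analysis.
Context (R : realType).

Definition scalars : fspace R := @FSpace R R^o setT (fun x => `|x|).

Definition bounded_linear (E F : fspace R) (T : E -> F) : Prop :=
  [/\ forall u, fmem u -> fmem (T u),
      forall (a : R) u v, fmem u -> fmem v ->
        fnorm (T (a *: u + v) - (a *: T u + T v)) = 0
    & exists C : R, forall u, fmem u -> fnorm (T u) <= C * fnorm u].

Definition dual (E : fspace R) : set (E -> scalars) :=
  [set l | bounded_linear l].

Definition weak_cvg (E : fspace R) (u_ : nat -> E) (u : E) : Prop :=
  [/\ forall k, fmem (u_ k), fmem u
    & forall l, dual l -> l (u_ k) @[k --> \oo] --> l u].

End functional_analysis.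

Section lebesgue_spaces.
Context (R : realType).

(* Functions are defined on the whole ambient type; only their values on D
   matter. *)
Definition Lp d (T : measurableType d) (mu : {measure set T -> \bar R})
    (D : set T) (p : \bar R) : fspace R :=
  @FSpace R (T -> R) [set f | f \_ D \in Lfun mu p]
    (fun f => fine 'N[mu]_p[EFin \o (f \_ D)]).

Context (n : nat) (Omega : set 'rV[R]_n).

Definition L2 : fspace R := Lp (leb R n) Omega 2%:E.

Definition L2vec : fspace R :=
  @FSpace R ('rV[R]_n -> 'rV[R]_n)
    [set F | forall i, @fmem R L2 (fun x => F x ord0 i)]
    (fun F => Num.sqrt (\sum_i @fnorm R L2 (fun x => F x ord0 i) ^+ 2)).

End lebesgue_spaces.

Section sobolev.
Context (R : realType) (n : nat).
Implicit Types (phi : 'rV[R]_n -> R) (D Omega : set 'rV[R]_n).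

Definition partial (i : 'I_n) phi : 'rV[R]_n -> R :=
  fun x => 'D_(delta_mx ord0 i) phi x.

Definition smooth phi : Prop :=
  forall (s : seq 'I_n) x, differentiable (foldr partial phi s) x.

Definition test_function Omega phi : Prop :=
  [/\ smooth phi, compact (closure [set x | phi x != 0])
    & closure [set x | phi x != 0] `<=` Omega].

Definition weak_gradient Omega (v : 'rV[R]_n -> R) (G : 'rV[R]_n -> 'rV[R]_n) :=
  forall phi i, test_function Omega phi ->
    \int[leb R n]_(x in Omega) (v x * partial i phi x) =
    - \int[leb R n]_(x in Omega) (G x ord0 i * phi x).

(* A Sobolev function is represented by a pair (v, G) of a function and a
   representative of its weak gradient; G is determined by v almost everywhere
   on Omega. *)
Definition sobolev : lmodType R :=
  (('rV[R]_n -> R) * ('rV[R]_n -> 'rV[R]_n))%type.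

Definition grad (u : sobolev) : 'rV[R]_n -> 'rV[R]_n := u.2.

Definition classical phi : sobolev := (phi, fun x => \row_i partial i phi x).

Definition H1 Omega : fspace R :=
  @FSpace R sobolev
    [set u | [/\ @fmem R (L2 Omega) u.1, @fmem R (L2vec Omega) (grad u)
               & weak_gradient Omega u.1 (grad u)]]
    (fun u => Num.sqrt (@fnorm R (L2 Omega) u.1 ^+ 2
                        + @fnorm R (L2vec Omega) (grad u) ^+ 2)).

Definition H10 Omega : fspace R :=
  @FSpace R sobolev
    [set u | @fmem R (H1 Omega) u /\
      exists2 phi_ : nat -> 'rV[R]_n -> R,
        forall k, test_function Omega (phi_ k)
        & @fnorm R (H1 Omega) (u - classical (phi_ k)) @[k --> \oo] --> (0 : R)]
    (@fnorm R (H1 Omega)).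

Definition boundary Omega : set 'rV[R]_n := closure Omega `\` interior Omega.

(* The exponent is dim + 2 * (1/2), with dim = n - 1 the dimension of the
   boundary. *)
Definition gagliardo Omega (f : 'rV[R]_n -> R) : \bar R :=
  (\int[surface R n]_(x in boundary Omega)
     \int[surface R n]_(y in boundary Omega)
       ((f x - f y) ^+ 2 / enorm (x - y) ^+ n)%:E)%E.

Definition Hhalf Omega : fspace R :=
  @FSpace R ('rV[R]_n -> R)
    [set f | @fmem R (Lp (surface R n) (boundary Omega) 2%:E) f
             /\ (gagliardo Omega f < +oo)%E]
    (fun f => Num.sqrt
       (@fnorm R (Lp (surface R n) (boundary Omega) 2%:E) f ^+ 2
        + fine (gagliardo Omega f))).

(* The bounded operator extending the restriction to the boundary of functions
   that are smooth up to the boundary; on a bounded Lipschitz domain it is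
   unique by density. *)
Definition trace_operator Omega (gamma : H1 Omega -> Hhalf Omega) : Prop :=
  bounded_linear gamma /\
  forall phi, smooth phi ->
    {ae surface R n, forall x, boundary Omega x ->
      gamma (classical phi) x = phi x}.

Definition extension_operator Omega (gamma : H1 Omega -> Hhalf Omega)
    (eta : Hhalf Omega -> H1 Omega) : Prop :=
  bounded_linear eta /\
  forall f, fmem f -> fnorm (gamma (eta f) - f) = 0.

(* Near each boundary point, and up to an orthogonal change of coordinates,
   Omega is the strict epigraph of a Lipschitz function of n - 1 variables. *)
Definition lipschitz_boundary Omega : Prop :=
  forall x, boundary Omega x ->
    exists (r : R) (Q : 'M[R]_n) (i : 'I_n) (psi : 'rV[R]_n.-1 -> R),
      [/\ 0 < r, Q *m Q^T = 1%:M, lipschitz psi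
        & Omega `&` ball x r =
          [set y | psi (col' i (y *m Q)) < (y *m Q) ord0 i] `&` ball x r].

Definition bounded_lipschitz_domain Omega : Prop :=
  [/\ Omega !=set0, open Omega, connected Omega, bounded_set Omega
    & lipschitz_boundary Omega].

Definition Linfty_range Omega (b c : R) : set ('rV[R]_n -> R) :=
  [set a | @fmem R (Lp (leb R n) Omega +oo%E) a /\
    {ae leb R n, forall x, Omega x -> b <= a x <= c}].

(* L^oo(Omega) is seen as the dual of L^1(Omega). *)
Definition weak_star_cvg Omega (a_ : nat -> 'rV[R]_n -> R)
    (a : 'rV[R]_n -> R) : Prop :=
  forall g, @fmem R (Lp (leb R n) Omega 1%E) g ->
    \int[leb R n]_(x in Omega) (a_ k x * g x) @[k --> \oo] -->
    \int[leb R n]_(x in Omega) (a x * g x).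

Definition flux (a : 'rV[R]_n -> R) (u : sobolev) : 'rV[R]_n -> 'rV[R]_n :=
  fun x => a x *: grad u x.

(* An element of H^-1(Omega), i.e., a functional on H^1_0(Omega). *)
Definition divergence Omega (F : 'rV[R]_n -> 'rV[R]_n) : sobolev -> R :=
  fun v => - \int[leb R n]_(x in Omega) edot (F x) (grad v x).

(* The equation - div (a grad u) = h holds in H^-1(Omega). *)
Definition dirichlet_solution Omega (a : 'rV[R]_n -> R) (h : sobolev -> R)
    (u : sobolev) : Prop :=
  @fmem R (H10 Omega) u /\
  forall v, @fmem R (H10 Omega) v -> - divergence Omega (flux a u) v = h v.

End sobolev.

(* Main.v *)
Require Import Defs.
From HB Require Import structures.
From mathcomp Require Import all_boot all_order all_algebra.
From mathcomp Require Import all_classical all_reals all_analysis.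
From mathcomp Require Import measurable_realfun ring lra.
Import Order.TTheory GRing.Theory Num.Theory.
Import numFieldNormedType.Exports.
Local Open Scope classical_set_scope.
Local Open Scope ring_scope.

Set Implicit Arguments.
Unset Strict Implicit.
Unset Printing Implicit Defensive.

(** The three limits are consequences of strong convergence: u_n tends to u in
    the norm of H^1_0, and everything else is continuity of inner products.

    Write g for the extension of the boundary datum, U = u + g and
    w_n = u_n - u.  The two equations say that alpha grad U and
    alpha_n grad (u_n + g) are both orthogonal in L^2 to gradients of H^1_0
    functions ([dirichlet_orthogonal]).  Testing both with w_n and subtracting,
    alpha_n grad w_n and -(alpha_n - alpha) grad U have the same product with
    grad w_n, hence, since alpha_n >= b and by Cauchy-Schwarz,
        b |grad w_n| <= |(alpha_n - alpha) grad U|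
    ([dirichlet_energy_le]).  The right-hand side tends to 0: alpha_n - alpha is
    uniformly bounded and tends to 0 in L^1, so that multiplication by it tends
    to 0 strongly on L^2 ([L2_multiplier_cvg0]).

    The function w_n itself is then controlled by a Poincare inequality
    ([poincare]).  It is obtained without slicing Omega and without the
    fundamental theorem of calculus: the definition of the weak gradient is
    tested with x_k phi, where phi runs through the test functions that
    approximate w_n.

    Finally alpha_n grad u_n - alpha grad u
    = alpha_n grad w_n + (alpha_n - alpha) grad u tends to 0 in L^2
    ([mulv_cvg]), strong convergence implies weak convergence
    ([strong_weak_cvg]), and the energy is the L^2 product of
    alpha_n grad (u_n + g) with grad (u_n + g), two strongly convergent factors
    ([inner_cvg]). *)

(** * Semi-inner products on spaces of representatives *)

Lemma squeeze_norm0 (R : realType) (f h : nat -> R) :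
  (forall k, `|f k| <= h k) -> h k @[k --> \oo] --> (0 : R) ->
  f k @[k --> \oo] --> (0 : R).
Proof.
move=> fh h0; apply: norm_cvg0.
apply: (@squeeze_cvgr _ _ _ _ (cst 0) h) h0; last exact: cvg_cst.
by apply: nearW => k; rewrite normr_ge0 fh.
Qed.

Lemma cvg_linear0 (R : realType) (a : R) (f g : nat -> R) :
  f k @[k --> \oo] --> (0 : R) -> g k @[k --> \oo] --> (0 : R) ->
  a * f k + g k @[k --> \oo] --> (0 : R).
Proof.
move=> f0 g0; rewrite -[0 : R](_ : a * 0 + 0 = 0); last by rewrite mulr0 addr0.
by apply: cvgD => //; exact: cvgMr.
Qed.

Lemma cvg_const0 (R : realType) (f : nat -> R) (l : R) :
  f k @[k --> \oo] --> l -> (forall k, f k = 0) -> l = 0.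
Proof.
move=> fl f0; apply: (@cvg_unique _ (@Rhausdorff R) _ _ _ _ fl).
by apply: cvg_near_cst; exact: nearW.
Qed.

Section pre_hilbert.
Context (R : realType).

(** The norm of a space of representatives is a seminorm on its members, so
    the form behind it is only required to be semidefinite, and only on
    members. Stating the axioms for a form q given from outside lets L^2,
    L^2(R^n)^n, H^1 and H^1_0 share the same theory although their norms are
    not defined from an inner product. *)
Record pre_hilbert (E : fspace R) (q : E -> E -> R) : Prop := PreHilbert {
  fmem_linear : forall (a : R) (u v : E),
    fmem u -> fmem v -> fmem (a *: u + v) ;
  innerC : forall u v, fmem u -> fmem v -> q u v = q v u ;
  inner_linear : forall (a : R) (u v w : E), fmem u -> fmem v -> fmem w ->
    q (a *: u + v) w = a * q u w + q v w ;
  inner_ge0 : forall u, fmem u -> 0 <= q u u ;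
  fnorm_inner : forall u, fmem u -> fnorm u = Num.sqrt (q u u) }.

Context (E : fspace R) (q : E -> E -> R) (qE : pre_hilbert q).
Implicit Types u v w : E.

Lemma sub_pre_hilbert (P : set E) : P `<=` @fmem R E ->
  (forall a u v, P u -> P v -> P (a *: u + v)) ->
  @pre_hilbert (FSpace P (@fnorm R E)) q.
Proof.
move=> PE Plin; split => //.
- by move=> u v /PE hu /PE hv; exact: (innerC qE).
- by move=> a u v w /PE hu /PE hv /PE hw; exact: (inner_linear qE).
- by move=> u /PE; exact: (inner_ge0 qE).
- by move=> u /PE; exact: (fnorm_inner qE).
Qed.

Lemma fmemD u v : fmem u -> fmem v -> fmem (u + v).
Proof. by move=> hu hv; rewrite -[u]scale1r; exact: (fmem_linear qE). Qed.

Lemma fmemB u v : fmem u -> fmem v -> fmem (u - v).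
Proof. by move=> hu hv; rewrite addrC -scaleN1r; exact: (fmem_linear qE). Qed.

Lemma fmem0 u : fmem u -> fmem (0 : E).
Proof. by move=> hu; rewrite -(subrr u); exact: fmemB. Qed.

Lemma fnorm_ge0 u : fmem u -> 0 <= fnorm u.
Proof. by move=> hu; rewrite (fnorm_inner qE hu) sqrtr_ge0. Qed.

Lemma fnorm_sqr u : fmem u -> fnorm u ^+ 2 = q u u.
Proof.
by move=> hu; rewrite (fnorm_inner qE hu) sqr_sqrtr// (inner_ge0 qE).
Qed.

Lemma innerDl u v w : fmem u -> fmem v -> fmem w -> q (u + v) w = q u w + q v w.
Proof.
by move=> hu hv hw; rewrite -[u in LHS]scale1r (inner_linear qE)// mul1r.
Qed.

Lemma innerBl u v w : fmem u -> fmem v -> fmem w -> q (u - v) w = q u w - q v w.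
Proof.
move=> hu hv hw; rewrite addrC -scaleN1r (inner_linear qE)//.
by rewrite mulN1r addrC.
Qed.

Lemma innerBr u v w : fmem u -> fmem v -> fmem w -> q w (u - v) = q w u - q w v.
Proof.
move=> hu hv hw; have huv := fmemB hu hv.
by rewrite (innerC qE)// innerBl// (innerC qE hu)// (innerC qE hv).
Qed.

Lemma inner_sqrDZ (t : R) u v : fmem u -> fmem v ->
  q (t *: u + v) (t *: u + v) = t ^+ 2 * q u u + 2 * t * q u v + q v v.
Proof.
move=> hu hv; have huv := fmem_linear qE t hu hv.
rewrite (inner_linear qE)// (innerC qE hu huv) (innerC qE hv huv).
rewrite !(inner_linear qE)// (innerC qE hv hu); ring.
Qed.

(** The square of t u + v is nonnegative for every t. As the form may be
    degenerate, the case where u has norm 0 has to be treated apart. *)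
Lemma cauchy_schwarz u v : fmem u -> fmem v -> `|q u v| <= fnorm u * fnorm v.
Proof.
move=> hu hv.
have h t : 0 <= t ^+ 2 * q u u + 2 * t * q u v + q v v.
  by rewrite -inner_sqrDZ//; exact/(inner_ge0 qE)/(fmem_linear qE).
suff : q u v ^+ 2 <= q u u * q v v.
  move=> hq; rewrite -sqrtr_sqr !(fnorm_inner qE)// -sqrtrM ?(inner_ge0 qE)//.
  exact: ler_wsqrtr.
have := inner_ge0 qE hu; rewrite le_eqVlt => /predU1P[u0|u0].
  have [->|uv0] := eqVneq (q u v) 0; first by rewrite -u0; lra.
  (* the square of t u + v is affine in t, and equals -1 for this t *)
  have := h (- (q v v + 1) / (2 * q u v)).
  rewrite -u0 mulr0 add0r.
  rewrite (_ : 2 * _ * _ = - (q v v + 1)); last by field.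
  lra.
(* the minimizer of the square of t u + v *)
have := h (- q u v / q u u).
rewrite (_ : _ + _ + _ = (q u u * q v v - q u v ^+ 2) / q u u); last first.
  by field; rewrite gt_eqF.
by rewrite pmulr_lge0 ?invr_gt0// subr_ge0.
Qed.

Lemma fnormD u v : fmem u -> fmem v -> fnorm (u + v) <= fnorm u + fnorm v.
Proof.
move=> hu hv; have huv := fmemD hu hv.
rewrite -ler_sqr ?nnegrE ?addr_ge0 ?fnorm_ge0//.
rewrite fnorm_sqr// -[u in q (u + v) (u + v)]scale1r inner_sqrDZ//.
have := le_trans (ler_norm _) (cauchy_schwarz hu hv).
rewrite sqrrD !fnorm_sqr//; lra.
Qed.

Lemma fnormZ (a : R) u : fmem u -> fnorm (a *: u) = `|a| * fnorm u.
Proof.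
move=> hu.
have h0 := fmem0 hu.
have hau : fmem (a *: u) by rewrite -[_ *: _]addr0; exact: (fmem_linear qE).
have q0 w : fmem w -> q 0 w = 0.
  move=> hw; have := innerBl hu hu hw; rewrite !subrr; exact.
rewrite !(fnorm_inner qE)// -[a *: u]addr0 inner_sqrDZ//.
rewrite (innerC qE hu h0) !q0//.
by rewrite mulr0 !addr0 sqrtrM ?sqr_ge0// sqrtr_sqr.
Qed.

Lemma fnormBC u v : fmem u -> fmem v -> fnorm (u - v) = fnorm (v - u).
Proof.
move=> hu hv; rewrite -(opprB v u) -[- (v - u)]scaleN1r.
rewrite fnormZ ?normrN1 ?mul1r//.
exact: fmemB.
Qed.

Lemma inner_cvg (u_ v_ : nat -> E) (u v : E) :
  (forall k, fmem (u_ k)) -> (forall k, fmem (v_ k)) -> fmem u -> fmem v ->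
  fnorm (u_ k - u) @[k --> \oo] --> (0 : R) ->
  fnorm (v_ k - v) @[k --> \oo] --> (0 : R) ->
  q (u_ k) (v_ k) @[k --> \oo] --> q u v.
Proof.
move=> hu_ hv_ hu hv cu cv.
apply/subr_cvg0.
have : fnorm (u_ k - u) * fnorm (v_ k - v) + fnorm (u_ k - u) * fnorm v
       + fnorm u * fnorm (v_ k - v) @[k --> \oo] --> (0 : R).
  rewrite -[0 : R](_ : 0 * 0 + 0 * fnorm v + fnorm u * 0 = 0); last by ring.
  by apply: cvgD; [apply: cvgD; [exact: cvgM|exact: cvgMl]|exact: cvgMr].
apply: squeeze_norm0 => k.
have hud := fmemB (hu_ k) hu; have hvd := fmemB (hv_ k) hv.
rewrite (_ : q (u_ k) (v_ k) - q u v =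
  q (u_ k - u) (v_ k - v) + q (u_ k - u) v + q u (v_ k - v)); last first.
  by rewrite !innerBr// !innerBl//; ring.
apply: le_trans (ler_normD _ _) _; apply: lerD; last exact: cauchy_schwarz.
apply: le_trans (ler_normD _ _) _; apply: lerD; exact: cauchy_schwarz.
Qed.

(** Functionals of the dual are linear only up to the seminorm of their
    target; the target is R, whose seminorm separates points, so that they are
    linear. *)
Lemma strong_weak_cvg (u_ : nat -> E) (u : E) :
  (forall k, fmem (u_ k)) -> fmem u ->
  fnorm (u_ k - u) @[k --> \oo] --> (0 : R) -> weak_cvg u_ u.
Proof.
move=> hu_ hu cu; split=> // l [_ llin [C lC]].
apply/subr_cvg0.
have : C * fnorm (u_ k - u) @[k --> \oo] --> (0 : R).
  by rewrite -(mulr0 C); exact: cvgMr.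
apply: squeeze_norm0 => k.
have hd := fmemB (hu_ k) hu.
have /= /normr0P/eqP := llin 1 _ _ hd hu.
rewrite !scale1r subrK => /subr0_eq lE.
by apply: le_trans (lC _ hd); rewrite lE addrK.
Qed.

End pre_hilbert.

(** * Square-integrable functions and bounded multipliers *)

Section L2_theory.
Context d (T : measurableType d) (R : realType) (mu : {measure set T -> \bar R}).
Variables (D : set T) (mD : measurable D).
Implicit Types f g h a : T -> R.

Definition L2form f g : R := \int[mu]_(x in D) (f x * g x).

Let restrict_sqr f : (f \_ D) ^+ 2 = (fun x => f x ^+ 2) \_ D.
Proof.
apply/funext => x; rewrite !expr2 /= !patchE.
by case: ifP => //= xD; rewrite fctE patchE xD // mulr0.
Qed.

(** Members of L^2 are defined through their extension by 0 outside D. This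
    form is intrinsic to D, where products and comparisons take place. *)
Lemma Lp2P f : fmem (f : Lp mu D 2%:E) <->
  measurable_fun D f /\ mu.-integrable D (EFin \o (fun x => f x ^+ 2)).
Proof.
split=> [f2|[mf if2]].
  split.
    apply/(measurable_restrictT _ mD).
    by move: f2 => /= /andP[]; rewrite !inE.
  apply/(integrable_mkcond _ mD); rewrite restrict_EFin -restrict_sqr.
  exact: Lfun2_integrable_sqr.
rewrite /= inE; apply/andP; split; rewrite !inE /=.
  exact/(measurable_restrictT _ mD).
rewrite /finite_norm unlock; apply: poweR_lty.
move/(integrable_mkcond _ mD) : if2; rewrite restrict_EFin -restrict_sqr.
move=> /integrableP[_]; apply: le_lt_trans.
rewrite le_eqVlt; apply/orP; left; apply/eqP; apply: eq_integral => x _.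
by rewrite /= powR_mulrn// -normrX.
Qed.

Lemma integrableM_L2 f g : fmem (f : Lp mu D 2%:E) -> fmem (g : Lp mu D 2%:E) ->
  mu.-integrable D (EFin \o (fun x => f x * g x)).
Proof.
move=> /= hf hg; apply/(integrable_mkcond _ mD); rewrite restrict_EFin.
have /Lfun1_integrable := Lfun2_mul_Lfun1 hf hg.
congr (integrable mu _ _); apply/funext => x /=; rewrite !patchE.
by case: ifP => //; rewrite mulr0.
Qed.

Lemma fnorm_L2 f : fmem (f : Lp mu D 2%:E) ->
  fnorm (f : Lp mu D 2%:E) = Num.sqrt (L2form f f).
Proof.
move=> /= hf; rewrite /L2form Rintegral_mkcond.
rewrite unlock/=.
have -> : (\int[mu]_x (`|(f \_ D) x| `^ 2)%:E)%E =
          (\int[mu]_x ((fun y => f y * f y) \_ D) x)%:E.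
  rewrite /Rintegral fineK.
    apply: eq_integral => x _.
    rewrite powR_mulrn// -normrX ger0_norm ?sqr_ge0// !patchE.
    by case: ifP => // _; rewrite expr2 mulr0.
  apply: (@integrable_fin_num _ _ _ mu setT) => //.
  rewrite -/(EFin \o _) -restrict_EFin; apply/(integrable_mkcond _ mD).
  exact: integrableM_L2.
rewrite /= powR12_sqrt//; apply: Rintegral_ge0 => x _; rewrite patchE.
by case: ifP => // _; rewrite -expr2 sqr_ge0.
Qed.

Lemma L2_pre_hilbert :
  @pre_hilbert R (Lp mu D 2%:E) L2form.
Proof.
split=> [a u v hu hv|u v _ _|a u v w hu hv hw|u _|u hu].
- rewrite /fmem/=.
  have -> : (a *: u + v : T -> R) \_ D = a *: (u \_ D) + v \_ D.
    apply/funext => x; rewrite !fctE /= !patchE.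
    by case: ifP => // _; rewrite scaler0 addr0.
  by apply: (Lfun_submod_closed mu _).2 => //; rewrite lee1n.
- by apply: eq_Rintegral => x _; rewrite mulrC.
- rewrite /L2form -RintegralZl//; last exact: integrableM_L2.
  rewrite -RintegralD//; last 2 first.
  - exact: (integrableZl mD a (integrableM_L2 hu hw)).
  - exact: integrableM_L2.
  by apply: eq_Rintegral => x _; rewrite !fctE mulrDl -mulrA.
- by apply: Rintegral_ge0 => x _; rewrite -expr2 sqr_ge0.
- exact: fnorm_L2.
Qed.

End L2_theory.

Section ae_bounds.
Context d (T : measurableType d) (R : realType) (mu : {measure set T -> \bar R}).
Variables (D : set T) (mD : measurable D).
Implicit Types f g h a : T -> R.

Lemma ae_integrable f g : measurable_fun D f ->
  mu.-integrable D (EFin \o g) -> {ae mu, forall x, D x -> `|f x| <= g x} ->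
  mu.-integrable D (EFin \o f).
Proof.
move=> mf ig fg; apply/integrableP; split; first exact/measurable_EFinP.
have [mg lg] := integrableP _ _ _ ig; apply: le_lt_trans lg.
apply: ae_ge0_le_integral => //.
- by apply: measurableT_comp => //; exact/measurable_EFinP.
- exact: measurableT_comp.
- apply: filterS fg => x fg Dx; rewrite /= lee_fin (le_trans (fg Dx))//.
  exact: ler_norm.
Qed.

Lemma ae_le_Rintegral f g : mu.-integrable D (EFin \o f) ->
  mu.-integrable D (EFin \o g) -> {ae mu, forall x, D x -> f x <= g x} ->
  \int[mu]_(x in D) f x <= \int[mu]_(x in D) g x.
Proof.
move=> iF iG [N [mN N0 fgN]].
rewrite /Rintegral (negligible_integral mN mD iF N0).
rewrite (negligible_integral mN mD iG N0).
have mDN : measurable (D `\` N) by exact: measurableD.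
apply: (le_Rintegral mDN).
- exact: (integrableS mD).
- exact: (integrableS mD).
- by move=> x [Dx Nx]; apply: contrapT => fg; apply: Nx; apply: fgN => /(_ Dx).
Qed.

(** Multiplication by a bounded coefficient and by a coordinate on a bounded
    domain are both handled by this comparison. *)
Lemma L2_dominated h f (M : R) : measurable_fun D h ->
  fmem (f : Lp mu D 2%:E) ->
  {ae mu, forall x, D x -> `|h x| <= M * `|f x|} ->
  fmem (h : Lp mu D 2%:E) /\
  fnorm (h : Lp mu D 2%:E) <= `|M| * fnorm (f : Lp mu D 2%:E).
Proof.
move=> mh hf hM; have [mf if2] := (Lp2P mu mD f).1 hf.
have hM2 : {ae mu, forall x, D x -> h x ^+ 2 <= M ^+ 2 * f x ^+ 2}.
  apply: filterS hM => x hM /hM {}hM.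
  rewrite -(real_normK (num_real (h x))) -(real_normK (num_real (f x))) -exprMn.
  by rewrite lerXn2r ?nnegrE// (le_trans _ hM).
have iM : mu.-integrable D (EFin \o (fun x => M ^+ 2 * f x ^+ 2)).
  exact: (integrableZl mD (M ^+ 2) if2).
have h2 : fmem (h : Lp mu D 2%:E).
  apply/(Lp2P mu mD); split=> //; apply: ae_integrable iM _.
    exact: measurable_funX.
  by apply: filterS hM2 => x hM2 /hM2; rewrite ger0_norm ?sqr_ge0.
split=> //; rewrite !fnorm_L2// -sqrtr_sqr -sqrtrM ?sqr_ge0//.
apply: ler_wsqrtr; rewrite /L2form -RintegralZl//.
apply: ae_le_Rintegral.
- exact: integrableM_L2.
- exact: (integrableZl mD (M ^+ 2) (integrableM_L2 mD hf hf)).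
- by apply: filterS hM2 => x hM2 /hM2; rewrite !expr2.
Qed.

(** The integrand is dominated by g and vanishes at x once t is at least g(x). *)
Lemma integral_trunc_cvg0 g : (forall x, 0 <= g x) ->
  mu.-integrable D (EFin \o g) ->
  \int[mu]_(x in D) (g x - Num.min (g x) t%:R) @[t --> \oo] --> (0 : R).
Proof.
move=> g0 ig; have mg : measurable_fun D g.
  by apply/measurable_EFinP; exact: measurable_int ig.
pose r t x := g x - Num.min (g x) t%:R.
have r0 t x : 0 <= r t x by rewrite subr_ge0 ge_min lexx.
have mr t : measurable_fun D (EFin \o r t).
  apply/measurable_EFinP/measurable_funB => //.
  by apply: measurable_minr => //; exact: measurable_cst.
have rcvg : {ae mu, forall x, D x -> (r t x)%:E @[t --> \oo] --> 0%E}.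
  apply: aeW => x Dx; apply: cvg_near_cst.
  exists (Num.trunc (g x)).+1 => // t /= ht; rewrite /r.
  by rewrite min_l ?subrr// (le_trans (ltW (truncnS_gt _)))// ler_nat.
have rg : {ae mu, forall x t, D x -> (`|(r t x)%:E| <= (EFin \o g) x)%E}.
  apply: aeW => x t Dx; rewrite /= lee_fin ger0_norm// /r lerBlDr lerDl.
  by rewrite le_min g0 ler0n.
have [_ _] := dominated_convergence mD mr (measurable_cst 0%E) rcvg ig rg.
by rewrite integral0 => /fine_cvg.
Qed.

(** The factor g only lies in L^2, so its square is cut at height t: below t the
    L^1 norm of a_k controls the integral, and the part above t is small
    uniformly in k. *)
Lemma L2_multiplier_cvg0 (a_ : nat -> T -> R) (M : R) g :
  (forall k, mu.-integrable D (EFin \o a_ k)) ->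
  (forall k, {ae mu, forall x, D x -> `|a_ k x| <= M}) ->
  \int[mu]_(x in D) `|a_ k x| @[k --> \oo] --> (0 : R) ->
  fmem (g : Lp mu D 2%:E) ->
  fnorm ((fun x => a_ k x * g x) : Lp mu D 2%:E) @[k --> \oo] --> (0 : R).
Proof.
move=> ia aM a0 hg; have [mg ig2] := (Lp2P mu mD g).1 hg.
have ma k : measurable_fun D (a_ k).
  by apply/measurable_EFinP; exact: measurable_int (ia k).
have hag k : fmem ((fun x => a_ k x * g x) : Lp mu D 2%:E).
  have /(_ _ _)[] // := @L2_dominated (fun x => a_ k x * g x) g M _ hg.
    exact: measurable_funM.
  by apply: filterS (aM k) => x aM' /aM' {}aM'; rewrite normrM ler_wpM2r.
pose F k := L2form mu D (fun x => a_ k x * g x) (fun x => a_ k x * g x).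
suff F0 : F k @[k --> \oo] --> (0 : R).
  under eq_fun do rewrite fnorm_L2//.
  rewrite -[0 : R]sqrtr0.
  exact: (continuous_cvg _ (@sqrt_continuous R _) F0).
pose r t x := g x ^+ 2 - Num.min (g x ^+ 2) t%:R.
have r_cvg := integral_trunc_cvg0 (fun x => sqr_ge0 (g x)) ig2.
have r0 t x : 0 <= r t x by rewrite subr_ge0 ge_min lexx.
have ir t : mu.-integrable D (EFin \o r t).
  apply: ae_integrable ig2 _.
    apply: measurable_funB; first exact: measurable_funX.
    by apply: measurable_minr => //; exact: measurable_funX.
  apply: aeW => x Dx; rewrite ger0_norm// lerBlDr lerDl le_min sqr_ge0.
  exact: ler0n.
(* a_k^2 g^2 = a_k^2 min(g^2, t) + a_k^2 r_t, where a_k^2 <= M |a_k| is used in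
   the first term and a_k^2 <= M^2 in the second *)
have bound t k : F k <= M * t%:R * \int[mu]_(x in D) `|a_ k x|
                       + M ^+ 2 * \int[mu]_(x in D) r t x.
  have ina := integrable_norm (ia k).
  rewrite -!RintegralZl// -RintegralD//; last 2 first.
  - exact: (integrableZl mD (M * t%:R) ina).
  - exact: (integrableZl mD (M ^+ 2) (ir t)).
  apply: ae_le_Rintegral.
  - exact: integrableM_L2.
  - exact: (integrableD mD (integrableZl mD (M * t%:R) ina)
                           (integrableZl mD (M ^+ 2) (ir t))).
  - apply: filterS (aM k) => x aM' /aM' {}aM'.
    have M0 : 0 <= M := le_trans (normr_ge0 _) aM'.
    rewrite (_ : _ * _ = `|a_ k x| * `|a_ k x| * g x ^+ 2); last first.
      by rewrite -normrM -expr2 ger0_norm ?sqr_ge0//; ring.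
    rewrite (_ : g x ^+ 2 = Num.min (g x ^+ 2) t%:R + r t x); last first.
      by rewrite /r addrC subrK.
    rewrite mulrDr; apply: lerD.
      rewrite -mulrA [leRHS]mulrAC -mulrA; apply: ler_pM => //.
        by rewrite mulr_ge0// le_min sqr_ge0 ler0n.
      by apply: ler_wpM2l => //; rewrite ge_min lexx orbT.
    by apply: ler_wpM2r => //; rewrite expr2; exact: ler_pM.
apply/cvgr0Pnorm_lt => e e0.
have [t rt] : exists t, M ^+ 2 * \int[mu]_(x in D) r t x < e / 2.
  have /cvgr0Pnorm_lt/(_ (e / 2)) : M ^+ 2 * \int[mu]_(x in D) r t x
      @[t --> \oo] --> (0 : R) by rewrite -(mulr0 (M ^+ 2)); exact: cvgMr.
  rewrite divr_gt0// => /(_ isT)[t _ /(_ t (leqnn t))] /= ht.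
  by exists t; apply: le_lt_trans (ler_norm _) ht.
have /cvgr0Pnorm_lt/(_ (e / 2)) : M * t%:R * \int[mu]_(x in D) `|a_ k x|
    @[k --> \oo] --> (0 : R) by rewrite -(mulr0 (M * t%:R)); exact: cvgMr.
rewrite divr_gt0// => /(_ isT); apply: filterS => k hk.
rewrite ger0_norm; last exact: (inner_ge0 (L2_pre_hilbert mu mD) (hag k)).
apply: le_lt_trans (bound t k) _; rewrite [ltRHS]splitr.
by apply: ltrD rt; apply: le_lt_trans (ler_norm _) hk.
Qed.

Lemma L2form_coercive a f (b : R) :
  {ae mu, forall x, D x -> b <= a x} ->
  fmem (f : Lp mu D 2%:E) -> fmem ((fun x => a x * f x) : Lp mu D 2%:E) ->
  b * L2form mu D f f <= L2form mu D (fun x => a x * f x) f.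
Proof.
move=> ab hf haf; rewrite /L2form -RintegralZl//; last exact: integrableM_L2.
apply: ae_le_Rintegral.
- exact: (integrableZl mD b (integrableM_L2 mD hf hf)).
- exact: integrableM_L2.
- apply: filterS ab => x ab /ab {}ab; rewrite -mulrA ler_wpM2r//.
  by rewrite -expr2 sqr_ge0.
Qed.

End ae_bounds.

(** * Borel sets and bounded sets of R^n *)

Section borel_rV.
Context (R : realType) (n : nat).
Implicit Types (x y : 'rV[R]_n) (A : set 'rV[R]_n).

Lemma mx_norm_coord x i : `|x ord0 i| <= `|x|.
Proof.
by rewrite [leRHS]mx_normrE; apply: (le_bigmax _ _ (ord0, i)).
Qed.

Lemma measurable_coord_preimage i (B : set R) : measurable B ->
  measurable [set x : 'rV[R]_n | B (x ord0 i)].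
Proof.
move=> mB; rewrite -[X in measurable X]setTI.
exact: (@measurable_coord R n i measurableT B mB).
Qed.

Lemma measurable_box (I : 'I_n -> interval R) :
  measurable [set x : 'rV[R]_n | forall i, x ord0 i \in I i].
Proof.
rewrite (_ : [set x | _] = \bigcap_(i in [set: 'I_n])
    [set x : 'rV[R]_n | [set` I i] (x ord0 i)]).
  apply: fin_bigcap_measurable => // i _.
  by apply: measurable_coord_preimage; exact: measurable_itv.
by apply/seteqP; split=> x /= h i => [_|]; exact: h.
Qed.

(** The sigma-algebra is generated by the coordinates, whereas open sets come
    from the metric: an open set is a countable union of boxes with rational
    corners. *)
Lemma open_measurable_rV A : open A -> measurable A.
Proof.
move=> oA.
pose box (pq : 'rV[rat]_n * 'rV[rat]_n) := [set x : 'rV[R]_n | forall i,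
  x ord0 i \in `]ratr (pq.1 ord0 i), ratr (pq.2 ord0 i)[%R].
(* all pairs of corners are indices; boxes that leave A are replaced by set0 *)
rewrite (_ : A = \bigcup_pq (if `[< box pq `<=` A >] then box pq else set0)).
  apply: countable_bigcupT_measurable => // pq.
  by case: ifP => // _; exact: measurable_box.
apply/seteqP; split=> [x Ax|x [pq _]]; last first.
  by case: asboolP => [sub /sub|_ []].
have [e /= e0 xeA] := (nbhs_ballP _ _).1 (open_nbhs_nbhs (conj oA Ax)).
have lx i : x ord0 i - e < x ord0 i by rewrite ltrBlDr ltrDl.
have rx i : x ord0 i < x ord0 i + e by rewrite ltrDl.
pose pq := (\row_i projT1 (cid (rat_in_itvoo (lx i))),
            \row_i projT1 (cid (rat_in_itvoo (rx i)))).
exists pq => //; rewrite asboolT.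
  move=> i; rewrite /= !mxE; case: cid => /= p /itvP hp.
  by case: cid => /= q /itvP hq; rewrite in_itv/= hp hq.
move=> y hy; apply: xeA; split=> // i j; rewrite (ord1 i) {i}.
have := hy j; rewrite /= !mxE; case: cid => /= p /itvP hp.
case: cid => /= q /itvP hq /andP[py yq].
rewrite /ball/= ltr_distlC (le_lt_trans _ py) ?hp//=.
by rewrite (lt_le_trans yq)// hq.
Qed.

Lemma continuous_measurable_rV (f : 'rV[R]_n -> R) :
  continuous f -> measurable_fun setT f.
Proof.
move=> cf; apply: (measurability _ (RGenOInfty.measurableE R)) => //.
move=> /= _ [_ [a ->] <-]; rewrite setTI; apply: open_measurable_rV.
by apply: open_comp; [move=> x _; exact: cf|exact: rray_open].
Qed.

End borel_rV.

(** A cube of dimension n + 1 is the product of an interval and a cube of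
    dimension n, in accordance with the recursive definition of the measure. *)
Lemma leb_cube_lty (R : realType) n (M : R) :
  (leb R n [set x : 'rV[R]_n | forall i, (x ord0 i \in `[- M, M])%R] < +oo)%E.
Proof.
elim: n => [|n IH]; first by rewrite /= diracE; case: (_ \in _); rewrite ltry.
rewrite /= /cons_measure /pushforward.
rewrite (_ : _ @^-1` _ = `[- M, M]%classic `*`
    [set x : 'rV[R]_n | forall i, (x ord0 i \in `[- M, M])%R]).
  rewrite product_measure1E//; last exact: measurable_box.
  rewrite lte_mul_pinfty//= lebesgue_measure_itv/=; case: ifP => //.
apply/seteqP; split=> -[t x] /=.
  move=> h; split; first by have := h ord0; rewrite mxE unlift_none.
  by move=> i; have := h (lift ord0 i); rewrite mxE liftK.
by move=> [ht hx] i; rewrite mxE; case: unliftP => [j _|_] /=; [exact: hx|].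
Qed.

Lemma bounded_cube (R : realType) n (A : set 'rV[R]_n) : bounded_set A ->
  exists M : R, A `<=` [set x | forall i, (x ord0 i \in `[- M, M])%R].
Proof.
move=> [M [Mr AM]]; exists (M + 1) => x Ax i.
rewrite in_itv/= -ler_norml; apply: le_trans (mx_norm_coord x i) _.
by apply: (AM (M + 1)) => //; rewrite ltrDl.
Qed.

Lemma leb_bounded_lty (R : realType) n (A : set 'rV[R]_n) :
  measurable A -> bounded_set A -> (leb R n A < +oo)%E.
Proof.
move=> mA /bounded_cube[M AM]; apply: le_lt_trans (leb_cube_lty n M).
by apply: le_measure => //; rewrite inE//; exact: measurable_box.
Qed.

(** * Smooth functions and test functions *)

Section smooth.
Context (R : realType) (n : nat).
Implicit Types (f g phi psi : 'rV[R]_n -> R) (Omega : set 'rV[R]_n).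

(** Smoothness quantifies over all iterated partial derivatives. A class of
    differentiable functions that is stable under partial derivatives consists
    of smooth functions. Smoothness of linear combinations and of products
    with a coordinate is proved by exhibiting such a class. *)
Lemma smooth_coind (P : set ('rV[R]_n -> R)) :
  (forall phi, P phi -> forall x, differentiable phi x) ->
  (forall phi i, P phi -> P (partial i phi)) ->
  forall phi, P phi -> smooth phi.
Proof.
move=> Pd Pp phi Pphi s; suff : P (foldr (@partial R n) phi s) by exact: Pd.
by elim: s => //= i s; exact: Pp.
Qed.

Lemma smooth_differentiable phi x : smooth phi -> differentiable phi x.
Proof. by move=> sphi; exact: (sphi [::]). Qed.

Lemma smooth_partial i phi : smooth phi -> smooth (partial i phi).
Proof. by move=> sphi s x; rewrite -foldr_rcons; exact: sphi. Qed.

Lemma smooth_continuous phi : smooth phi -> continuous phi.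
Proof.
by move=> sphi x; exact/differentiable_continuous/smooth_differentiable.
Qed.

Lemma partial_linear i (a : R) phi psi : smooth phi -> smooth psi ->
  partial i (a *: phi + psi) = a *: partial i phi + partial i psi.
Proof.
move=> sphi spsi; apply/funext => x; rewrite /partial.
have dphi : derivable phi x (delta_mx ord0 i).
  exact/diff_derivable/smooth_differentiable.
have dpsi : derivable psi x (delta_mx ord0 i).
  exact/diff_derivable/smooth_differentiable.
have daphi : derivable (a *: phi) x (delta_mx ord0 i).
  exact/diff_derivable/differentiableZ/smooth_differentiable.
by rewrite (deriveD daphi dpsi) (deriveZ a dphi).
Qed.

Lemma smooth_linear (a : R) phi psi :
  smooth phi -> smooth psi -> smooth (a *: phi + psi).
Proof.
move=> sphi spsi.
apply: (@smooth_coind [set a *: f + g | f in @smooth R n & g in @smooth R n]).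
- move=> _ [f sf [g sg <-]] x.
  by apply: differentiableD; [apply: differentiableZ|]; exact: smooth_differentiable.
- move=> _ i [f sf [g sg <-]]; rewrite partial_linear//.
  exists (partial i f); first exact: smooth_partial.
  by exists (partial i g) => //; exact: smooth_partial.
- by exists phi => //; exists psi.
Qed.

Lemma partial_coord (i k : 'I_n) :
  partial i (fun x : 'rV[R]_n => x ord0 k) = cst (k == i)%:R.
Proof.
apply/funext => x; rewrite /partial /derive; apply/cvg_lim => //.
apply: cvg_near_cst; near=> h.
have h0 : h != 0 by near: h; exact: nbhs_dnbhs_neq.
rewrite /= !mxE eqxx/= addrK /GRing.scale/= mulrA mulVf// mul1r.
Unshelve. all: by end_near. Qed.

(** Leibniz rule; the extra term phi is the one that produces the square of
    the norm in the Poincare inequality. *)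
Lemma partial_coordM (i k : 'I_n) phi : smooth phi ->
  partial i (fun x => x ord0 k * phi x) =
  (fun x => x ord0 k * partial i phi x + (k == i)%:R * phi x).
Proof.
move=> sphi; apply/funext => x.
rewrite [LHS](@deriveM _ _ (fun y : 'rV[R]_n => y ord0 k)); last 2 first.
- exact/diff_derivable/differentiable_coord.
- exact/diff_derivable/smooth_differentiable.
congr (_ + _); rewrite /GRing.scale/= mulrC; congr (_ * _).
exact: (congr1 (fun f => f x) (partial_coord i k)).
Qed.

Lemma smooth_coordM (k : 'I_n) phi :
  smooth phi -> smooth (fun x => x ord0 k * phi x).
Proof.
move=> sphi.
(* differentiation does not preserve the multiples of a coordinate, but it does
   preserve their sums with smooth functions *)
apply: (@smooth_coind [set (fun x : 'rV[R]_n => x ord0 k * f x + g x)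
                      | f in @smooth R n & g in @smooth R n]).
- move=> _ [f sf [g sg <-]] x.
  have df := smooth_differentiable x sf.
  exact: (differentiableD (differentiableM (differentiable_coord x ord0 k) df)
                          (smooth_differentiable x sg)).
- move=> _ i [f sf [g sg <-]].
  exists (partial i f); first exact: smooth_partial.
  exists ((k == i)%:R *: f + partial i g).
    exact/smooth_linear/smooth_partial.
  apply/funext => x.
  rewrite [RHS](@deriveD _ _ _ (fun y : 'rV[R]_n => y ord0 k * f y) g).
  + have := congr1 (fun h => h x) (partial_coordM i k sf).
    by rewrite /partial => /= ->; rewrite addrA.
  + apply: diff_derivable.
    exact: (differentiableM (differentiable_coord x ord0 k)
                            (smooth_differentiable x sf)).
  + exact/diff_derivable/smooth_differentiable.
- exists phi => //; exists 0; last by apply/funext => x; rewrite addr0.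
  have := smooth_linear (- 1) sphi sphi.
  by rewrite scaleN1r addNr.
Qed.

Lemma test_function_sub Omega phi psi : smooth psi ->
  (forall x, phi x = 0 -> psi x = 0) ->
  test_function Omega phi -> test_function Omega psi.
Proof.
move=> spsi phi0 [_ cphi phiO].
have sub : closure [set x | psi x != 0] `<=` closure [set x | phi x != 0].
  by apply: closureS => x /=; apply: contra_neq; exact: phi0.
split=> //; last exact: subset_trans phiO.
by apply: subclosed_compact sub => //; exact: closed_closure.
Qed.

Lemma test_function_linear Omega (a : R) phi psi :
  test_function Omega phi -> test_function Omega psi ->
  test_function Omega (a *: phi + psi).
Proof.
move=> [sphi cphi phiO] [spsi cpsi psiO].
have sub : closure [set x | (a *: phi + psi) x != 0] `<=`
    closure [set x | phi x != 0] `|` closure [set x | psi x != 0].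
  rewrite -closureU; apply: closureS => x /=.
  have [p0|p0] := eqVneq (phi x) 0; last by left.
  by rewrite !fctE /= p0 scaler0 add0r; right.
split; first exact: smooth_linear.
- apply: subclosed_compact sub; first exact: closed_closure.
  exact: compactU.
- by move=> x /sub [/phiO|/psiO].
Qed.

(** The test function of the proof of the Poincare inequality. *)
Lemma test_function_coordM Omega (k : 'I_n) phi :
  test_function Omega phi -> test_function Omega (fun x => x ord0 k * phi x).
Proof.
move=> tphi; apply: test_function_sub (tphi).
  by apply: smooth_coordM; case: tphi.
by move=> x ->; rewrite mulr0.
Qed.

(** Applied to a test function and to its partial derivatives, which puts them
    in L^2 of a bounded domain. *)
Lemma compact_support_bounded (K : set 'rV[R]_n) f : continuous f -> compact K ->
  (forall x, ~ K x -> f x = 0) -> exists M : R, forall x, `|f x| <= M.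
Proof.
move=> cf cK f0.
have [M [_ fM]] : bounded_set (f @` K).
  by apply/compact_bounded/continuous_compact => //; exact: continuous_subspaceT.
exists (`|M| + 1) => x; have [Kx|/f0 ->] := pselect (K x); last first.
  by rewrite normr0 addr_ge0.
apply: (fM (`|M| + 1)); last by exists x.
by apply: le_lt_trans (ler_norm M) _; rewrite ltrDl.
Qed.

Lemma test_function_bounded Omega phi : test_function Omega phi ->
  exists M : R, forall x, `|phi x| <= M.
Proof.
move=> [sphi cphi _]; apply: compact_support_bounded cphi _.
  exact: smooth_continuous.
by move=> x xK; apply: contrapT => /eqP phix; apply: xK; exact: subset_closure.
Qed.

Lemma partial_test_function_bounded Omega i phi : test_function Omega phi ->
  exists M : R, forall x, `|partial i phi x| <= M.
Proof.
move=> [sphi cphi _]; apply: compact_support_bounded cphi _.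
  exact/smooth_continuous/smooth_partial.
move=> x xK; rewrite /partial.
rewrite (@near_eq_derive _ _ _ phi (cst 0)) ?derive_cst//.
have : nbhs x (~` closure [set x | phi x != 0]).
  by apply: open_nbhs_nbhs; split=> //; exact/closed_openC/closed_closure.
apply: filterS => y yK; apply: contrapT => /eqP phiy.
by apply: yK; exact: subset_closure.
Qed.

End smooth.

(** * Square-integrable vector fields *)

Section L2vec_theory.
Context (R : realType) (n : nat) (Omega : set 'rV[R]_n).
Hypothesis mO : measurable Omega.
Implicit Types (F G : 'rV[R]_n -> 'rV[R]_n) (a : 'rV[R]_n -> R).

Definition coor i F : 'rV[R]_n -> R := fun x => F x ord0 i.

Definition L2vec_form F G : R :=
  \sum_i L2form (leb R n) Omega (coor i F) (coor i G).

Lemma coor_linear i (a : R) F G : coor i (a *: F + G) = a *: coor i F + coor i G.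
Proof. by apply/funext => x; rewrite /coor !fctE !mxE. Qed.

Let L2H := L2_pre_hilbert (leb R n) mO.

Lemma L2vec_pre_hilbert :
  @pre_hilbert R (L2vec Omega) L2vec_form.
Proof.
split=> [a F G hF hG|F G hF hG|a F G H hF hG hH|F hF|F hF].
- move=> i; rewrite -/(coor i _) coor_linear.
  by apply: (fmem_linear L2H); [exact: hF|exact: hG].
- by apply: eq_bigr => i _; apply: (innerC L2H); [exact: hF|exact: hG].
- rewrite /L2vec_form mulr_sumr -big_split; apply: eq_bigr => i _ /=.
  rewrite coor_linear.
  by rewrite (inner_linear L2H)//; [exact: hF|exact: hG|exact: hH].
- by apply: sumr_ge0 => i _; apply: (inner_ge0 L2H); exact: hF.
- rewrite /=; congr Num.sqrt; apply: eq_bigr => i _.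
  by apply: (fnorm_sqr L2H); exact: hF.
Qed.

Lemma le_fnorm_coor i F : fmem (F : L2vec Omega) ->
  fnorm (coor i F : L2 Omega) <= fnorm (F : L2vec Omega).
Proof.
move=> hF; rewrite -(ger0_norm (fnorm_ge0 L2H (hF i))) -sqrtr_sqr.
rewrite /= ler_wsqrtr// (bigD1 i)//= lerDl.
by apply: sumr_ge0 => j _; exact: sqr_ge0.
Qed.

Lemma L2vec_cvg0 (F_ : nat -> 'rV[R]_n -> 'rV[R]_n) :
  (forall i, fnorm (coor i (F_ k) : L2 Omega) @[k --> \oo] --> (0 : R)) ->
  fnorm (F_ k : L2vec Omega) @[k --> \oo] --> (0 : R).
Proof.
move=> F0.
have : \sum_i fnorm (coor i (F_ k) : L2 Omega) ^+ 2 @[k --> \oo] --> (0 : R).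
  elim: (index_enum _) => [|i s IH].
    by under eq_fun do rewrite big_nil; exact: cvg_cst.
  under eq_fun do rewrite big_cons.
  have Fi : fnorm (coor i (F_ k) : L2 Omega) ^+ 2 @[k --> \oo] --> (0 : R).
    by have := cvgM (F0 i) (F0 i); rewrite mulr0; exact.
  by have := cvgD Fi IH; rewrite addr0; exact.
move=> S0; rewrite -[0 : R]sqrtr0.
exact: (continuous_cvg _ (@sqrt_continuous R _) S0).
Qed.

Lemma integral_edot F G : fmem (F : L2vec Omega) -> fmem (G : L2vec Omega) ->
  \int[leb R n]_(x in Omega) edot (F x) (G x) = L2vec_form F G.
Proof.
move=> hF hG; rewrite /L2vec_form /edot.
have iFG i : (leb R n).-integrable Omega
    (EFin \o (fun x => F x ord0 i * G x ord0 i)).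
  by exact: (integrableM_L2 mO (hF i) (hG i)).
suff : (leb R n).-integrable Omega
    (EFin \o (fun x => \sum_i F x ord0 i * G x ord0 i)) /\
  \int[leb R n]_(x in Omega) (\sum_i F x ord0 i * G x ord0 i) =
  \sum_i \int[leb R n]_(x in Omega) (F x ord0 i * G x ord0 i) by case.
elim: (index_enum _) => [|i s [iS IH]].
  have -> : (fun x => \sum_(i <- [::]) F x ord0 i * G x ord0 i) = (fun=> 0 : R).
    by apply/funext => x; rewrite big_nil.
  by rewrite big_nil Rintegral_cst// mul0r; split=> //; exact: integrable0.
have -> : (fun x => \sum_(i <- i :: s) F x ord0 i * G x ord0 i) =
    (fun x => F x ord0 i * G x ord0 i + \sum_(i <- s) F x ord0 i * G x ord0 i).
  by apply/funext => x; rewrite big_cons.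
rewrite big_cons -IH -RintegralD//; split=> //.
exact: (integrableD mO (iFG i) iS).
Qed.

Definition mulv a F : 'rV[R]_n -> 'rV[R]_n := fun x => a x *: F x.

Lemma coor_mulv i a F : coor i (mulv a F) = (fun x => a x * coor i F x).
Proof. by apply/funext => x; rewrite /coor mxE. Qed.

End L2vec_theory.

(** * Sobolev spaces and the Poincare inequality *)

Section sobolev_theory.
Context (R : realType) (n : nat) (Omega : set 'rV[R]_n).
Hypotheses (mO : measurable Omega) (bO : bounded_set Omega).
Implicit Types (phi psi : 'rV[R]_n -> R) (u v w : sobolev R n).

Local Notation mu := (leb R n).
Local Notation ip := (L2form mu Omega).
Let L2H := L2_pre_hilbert mu mO.
Let L2vecH := L2vec_pre_hilbert mO.

Lemma bounded_continuous_L2 (f : 'rV[R]_n -> R) (M : R) :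
  continuous f -> (forall x, `|f x| <= M) -> fmem (f : L2 Omega).
Proof.
move=> cf fM; have mf : measurable_fun Omega f.
  by apply: measurable_funTS; exact: continuous_measurable_rV.
apply/(Lp2P _ mO); split=> //; apply: measurable_bounded_integrable => //.
- exact: leb_bounded_lty.
- exact: measurable_funX.
- exists (M ^+ 2); split=> [|K MK x _ /=]; first exact: num_real.
  rewrite normrX (le_trans _ (ltW MK))// lerXn2r ?nnegrE//.
  exact: le_trans (fM x).
Qed.

Lemma test_function_L2 phi :
  test_function Omega phi -> fmem (phi : L2 Omega).
Proof.
move=> tphi; have [M phiM] := test_function_bounded tphi.
by apply: bounded_continuous_L2 phiM; apply: smooth_continuous; case: tphi.
Qed.

Lemma partial_test_function_L2 i phi :
  test_function Omega phi -> fmem (partial i phi : L2 Omega).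
Proof.
move=> tphi; have [M phiM] := partial_test_function_bounded i tphi.
apply: bounded_continuous_L2 phiM.
by apply/smooth_continuous/smooth_partial; case: tphi.
Qed.

Lemma coor_classical i phi : coor i (classical phi).2 = partial i phi.
Proof. by apply/funext => x; rewrite /coor mxE. Qed.

Lemma weak_gradientE (v : 'rV[R]_n -> R) G phi i : test_function Omega phi ->
  weak_gradient Omega v G -> ip v (partial i phi) = - ip (coor i G) phi.
Proof. by move=> tphi /(_ phi i tphi). Qed.

Definition H1form u v : R := ip u.1 v.1 + L2vec_form Omega u.2 v.2.

(** The H^1 norm also makes sense for pairs that are not known to satisfy the
    weak gradient relation. Elements of H^1_0 are approximated by classical
    pairs of test functions; treating those in this larger space avoids the
    integration by parts in several variables that would be needed to see them
    in H^1. *)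
Definition L2pair : fspace R :=
  @FSpace R (sobolev R n)
    [set u | @fmem R (L2 Omega) u.1 /\ @fmem R (L2vec Omega) (grad u)]
    (@fnorm R (H1 Omega)).

Lemma L2pair_pre_hilbert : @pre_hilbert R L2pair H1form.
Proof.
split=> [a u v [u1 u2] [v1 v2]|u v [u1 u2] [v1 v2]
  |a u v w [u1 u2] [v1 v2] [w1 w2]|u [u1 u2]|u [u1 u2]].
- by split; [exact: (fmem_linear L2H)|exact: (fmem_linear L2vecH)].
- by rewrite /H1form (innerC L2H)// (innerC L2vecH).
- rewrite /H1form (inner_linear L2H)// (inner_linear L2vecH)//; ring.
- by rewrite addr_ge0// ?(inner_ge0 L2H)// (inner_ge0 L2vecH).
- rewrite -[fnorm _]/(Num.sqrt (@fnorm R (L2 Omega) u.1 ^+ 2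
                        + @fnorm R (L2vec Omega) u.2 ^+ 2)).
  by rewrite (fnorm_sqr L2H)// (fnorm_sqr L2vecH).
Qed.

Let L2pairH := L2pair_pre_hilbert.

Lemma H1_pre_hilbert : @pre_hilbert R (H1 Omega) H1form.
Proof.
apply: (sub_pre_hilbert L2pairH) => [u []|a u v [u1 u2 wu] [v1 v2 wv]] //.
split; [exact: (fmem_linear L2H)|exact: (fmem_linear L2vecH)|].
move=> phi i tphi.
have hp := partial_test_function_L2 i tphi; have ht := test_function_L2 tphi.
rewrite -[LHS]/(ip (a *: u.1 + v.1) (partial i phi)).
rewrite -[X in _ = - X]/(ip (coor i (a *: u.2 + v.2)) phi) coor_linear.
rewrite (inner_linear L2H)// (inner_linear L2H)//; [|exact: u2|exact: v2].
by rewrite (weak_gradientE i tphi wu) (weak_gradientE i tphi wv) opprD mulrN.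
Qed.

Lemma le_fnorm_H1 u : fmem (u : L2pair) ->
  [/\ fnorm (u.1 : L2 Omega) <= fnorm (u : H1 Omega),
      fnorm (grad u : L2vec Omega) <= fnorm (u : H1 Omega)
    & fnorm (u : H1 Omega) <=
      fnorm (u.1 : L2 Omega) + fnorm (grad u : L2vec Omega)].
Proof.
move=> [u1 u2]; have := fnorm_ge0 L2H u1; have := fnorm_ge0 L2vecH u2.
rewrite -[fnorm (u : H1 Omega)]/(Num.sqrt (@fnorm R (L2 Omega) u.1 ^+ 2
                        + @fnorm R (L2vec Omega) (grad u) ^+ 2)).
move: (@fnorm R (L2vec Omega) _) => y; move: (@fnorm R (L2 Omega) _) => x y0 x0.
split.
- by rewrite -[leLHS]ger0_norm// -sqrtr_sqr ler_wsqrtr// lerDl sqr_ge0.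
- by rewrite -[leLHS]ger0_norm// -sqrtr_sqr ler_wsqrtr// lerDr sqr_ge0.
- rewrite -[leRHS]ger0_norm ?addr_ge0// -sqrtr_sqr ler_wsqrtr//.
  by rewrite sqrrD lerD2r lerDl mulrn_wge0// mulr_ge0.
Qed.

Lemma classical_linear (a : R) phi psi : smooth phi -> smooth psi ->
  classical (a *: phi + psi) = a *: classical phi + classical psi.
Proof.
move=> sphi spsi; congr pair; apply/funext => x; apply/rowP => i.
by rewrite !fctE !mxE partial_linear.
Qed.

Lemma classical_L2pair phi : test_function Omega phi ->
  fmem (classical phi : L2pair).
Proof.
move=> tphi; split; first exact: test_function_L2.
move=> i; rewrite -/(coor i _) coor_classical.
exact: partial_test_function_L2.
Qed.

Lemma H10_pre_hilbert : @pre_hilbert R (H10 Omega) H1form.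
Proof.
apply: (sub_pre_hilbert L2pairH) => [u [[]]//|a u v [hu [phi tphi cphi]]].
move=> [hv [psi tpsi cpsi]].
split; first exact: (fmem_linear H1_pre_hilbert).
exists (fun k => a *: phi k + psi k) => [k|]; first exact: test_function_linear.
have hup k : fmem (u - classical (phi k) : L2pair).
  by apply: (fmemB L2pairH); [case: hu|exact: classical_L2pair].
have hvp k : fmem (v - classical (psi k) : L2pair).
  by apply: (fmemB L2pairH); [case: hv|exact: classical_L2pair].
apply: (@squeeze_norm0 _ _ (fun k =>
    `|a| * fnorm (u - classical (phi k) : H1 Omega)
    + fnorm (v - classical (psi k) : H1 Omega))) => [k|]; last first.
  exact: (cvg_linear0 `|a| cphi cpsi).
rewrite classical_linear; [|by case: (tphi k)|by case: (tpsi k)].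
rewrite (_ : _ - _ = a *: (u - classical (phi k)) + (v - classical (psi k))).
  rewrite ger0_norm; last exact/(fnorm_ge0 L2pairH)/(fmem_linear L2pairH).
  have haup : fmem (a *: (u - classical (phi k)) : L2pair).
    rewrite -[_ *: _]addr0; apply: (fmem_linear L2pairH) => //.
    exact: (fmem0 L2pairH (hup k)).
  apply: le_trans (fnormD L2pairH haup (hvp k)) _.
  by rewrite lerD2r (fnormZ L2pairH a (hup k)).
by rewrite scalerBr opprD addrACA.
Qed.

Definition mul_coor (k : 'I_n) (f : 'rV[R]_n -> R) : 'rV[R]_n -> R :=
  fun x => x ord0 k * f x.

Lemma mul_coorC k f g : ip (mul_coor k f) g = ip f (mul_coor k g).
Proof. by apply: eq_Rintegral => x _; rewrite /mul_coor; ring. Qed.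

Lemma mul_coor_L2 (k : 'I_n) (M : R) (f : 'rV[R]_n -> R) :
  Omega `<=` [set x | forall i, (x ord0 i \in `[- M, M])%R] ->
  fmem (f : L2 Omega) ->
  fmem ((mul_coor k f) : L2 Omega) /\
  fnorm ((mul_coor k f) : L2 Omega) <= `|M| * fnorm (f : L2 Omega).
Proof.
move=> OM hf; have [mf _] := (Lp2P mu mO f).1 hf.
apply: (L2_dominated mO) => //.
  apply: measurable_funM => //.
  by apply: measurable_funTS; exact: measurable_coord.
apply: aeW => x /OM /(_ k); rewrite in_itv/= -ler_norml => xM.
by rewrite normrM ler_wpM2r.
Qed.

(** Testing the weak gradient of w against x_k phi gives
        <w, phi> + <x_k w, d_k phi> + <x_k d_k w, phi> = 0.
    When phi tends to w in H^1 this becomes |w|^2 + 2 <x_k w, d_k w> = 0, and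
    the conclusion is Cauchy-Schwarz, as |x_k| is at most some M on Omega. *)
Lemma poincare (k : 'I_n) : exists C : R, forall w, fmem (w : H10 Omega) ->
  fnorm (w.1 : L2 Omega) <= C * fnorm (grad w : L2vec Omega).
Proof.
have [M OM] := bounded_cube bO.
exists (2 * `|M|) => w [[w1 w2 gw] [phi tphi cphi]].
have wk : fmem (coor k (grad w) : L2 Omega) := w2 k.
have [xw xwM] := mul_coor_L2 k OM w1; have [xg _] := mul_coor_L2 k OM wk.
have test j : ip w.1 (phi j) + ip (mul_coor k w.1) (partial k (phi j))
    + ip (mul_coor k (coor k (grad w))) (phi j) = 0.
  have tx : test_function Omega (mul_coor k (phi j)).
    exact: test_function_coordM.
  have := weak_gradientE k tx gw.
  have sphi : smooth (phi j) by case: (tphi j).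
  rewrite /mul_coor partial_coordM// -!/(mul_coor _ _).
  have hp := test_function_L2 (tphi j).
  have hdp := partial_test_function_L2 k (tphi j).
  have [xdp _] := mul_coor_L2 k OM hdp.
  have -> : (fun x : 'rV[R]_n =>
      x ord0 k * partial k (phi j) x + (k == k)%:R * phi j x) =
      mul_coor k (partial k (phi j)) + phi j.
    by apply/funext => x; rewrite eqxx mul1r.
  rewrite (innerC L2H w1) ?(innerDl L2H)//; last exact: (fmemD L2H).
  rewrite (innerC L2H hp w1) mul_coorC (innerC L2H hdp xw) => h.
  by rewrite (mul_coorC _ (coor k (grad w))) [X in X + _]addrC h addNr.
have hpw j : fmem (classical (phi j) - w : L2pair).
  by apply: (fmemB L2pairH) => //; exact: classical_L2pair.
have normC j : fnorm (classical (phi j) - w : H1 Omega) =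
    fnorm (w - classical (phi j) : H1 Omega).
  by apply: (fnormBC L2pairH) => //; exact: classical_L2pair.
have c1 : fnorm (phi j - w.1 : L2 Omega) @[j --> \oo] --> (0 : R).
  apply: squeeze_norm0 cphi => j; rewrite -normC.
  rewrite ger0_norm; first by have [] := le_fnorm_H1 (hpw j).
  by apply: (fnorm_ge0 L2H); case: (hpw j).
have c2 : fnorm (partial k (phi j) - coor k (grad w) : L2 Omega)
    @[j --> \oo] --> (0 : R).
  apply: squeeze_norm0 cphi => j; rewrite -normC -coor_classical.
  have [_ hg] := hpw j; have := le_fnorm_coor mO k hg.
  rewrite (_ : coor k _ = coor k (classical (phi j)).2 - coor k (grad w)).
    move=> h; rewrite ger0_norm.
      by apply: le_trans h _; have [] := le_fnorm_H1 (hpw j).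
    apply: (fnorm_ge0 L2H); apply: (fmemB L2H) => //; rewrite coor_classical.
    exact: partial_test_function_L2.
  by apply/funext => x; rewrite /coor /grad !fctE !mxE.
have c0 (f : L2 Omega) : fmem f -> fnorm (f - f) @[j --> \oo] --> (0 : R).
  move=> hf; rewrite subrr.
  have := fnormZ L2H 0 hf; rewrite scale0r normr0 mul0r => ->; exact: cvg_cst.
have tp j := test_function_L2 (tphi j).
have tdp j := partial_test_function_L2 k (tphi j).
have lim : ip w.1 w.1 + ip (mul_coor k w.1) (coor k (grad w))
    + ip (mul_coor k (coor k (grad w))) w.1 = 0.
  have l1 := inner_cvg L2H (fun=> w1) tp w1 w1 (c0 _ w1) c1.
  have l2 := inner_cvg L2H (fun=> xw) tdp xw wk (c0 _ xw) c2.
  have l3 := inner_cvg L2H (fun=> xg) tp xg w1 (c0 _ xg) c1.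
  exact: (cvg_const0 (cvgD (cvgD l1 l2) l3) test).
have E : ip (mul_coor k (coor k (grad w))) w.1 =
    ip (mul_coor k w.1) (coor k (grad w)).
  by rewrite mul_coorC; exact: (innerC L2H wk xw).
rewrite {}E -(fnorm_sqr L2H w1) in lim.
have := cauchy_schwarz L2H xw wk; rewrite ler_norml => /andP[cs _].
have y0 := fnorm_ge0 L2H wk; have yz := le_fnorm_coor mO k w2.
have := fnorm_ge0 L2H w1; rewrite le_eqVlt => /predU1P[<-|x0].
  by rewrite mulr_ge0 ?mulr_ge0// (le_trans y0).
rewrite -(ler_pM2r x0) -expr2.
have h1 := ler_wpM2r y0 xwM.
have h2 := ler_wpM2l (mulr_ge0 (normr_ge0 M) (ltW x0)) yz.
lra.
Qed.

End sobolev_theory.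

(** * Coefficients converging in L^1 *)

Section coefficients.
Context (R : realType) (n : nat) (Omega : set 'rV[R]_n).
Hypotheses (mO : measurable Omega) (bO : bounded_set Omega).
Implicit Types (a : 'rV[R]_n -> R) (F : 'rV[R]_n -> 'rV[R]_n).
Local Notation mu := (leb R n).

Let L2H := L2_pre_hilbert mu mO.
Let L2vecH := L2vec_pre_hilbert mO.

Lemma mulv_L2vec a (M : R) F : measurable_fun Omega a ->
  {ae mu, forall x, Omega x -> `|a x| <= M} -> fmem (F : L2vec Omega) ->
  fmem (mulv a F : L2vec Omega) /\
  fnorm (mulv a F : L2vec Omega) <= `|M| * fnorm (F : L2vec Omega).
Proof.
move=> ma aM hF.
have h i : fmem (coor i (mulv a F) : L2 Omega) /\
    fnorm (coor i (mulv a F) : L2 Omega) <= `|M| * fnorm (coor i F : L2 Omega).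
  rewrite coor_mulv; apply: (L2_dominated mO _ (hF i)).
    apply: measurable_funM => //.
    by have [] := (Lp2P mu mO (coor i F)).1 (hF i).
  by apply: filterS aM => x aM /aM {}aM; rewrite normrM ler_wpM2r.
have haF : fmem (mulv a F : L2vec Omega) by move=> i; case: (h i).
split=> //; rewrite -[leLHS](ger0_norm (fnorm_ge0 L2vecH haF)) -sqrtr_sqr.
rewrite -[leRHS]ger0_norm ?mulr_ge0 ?(fnorm_ge0 L2vecH hF)// -sqrtr_sqr.
rewrite ler_wsqrtr// exprMn !(fnorm_sqr L2vecH)// /L2vec_form mulr_sumr.
apply: ler_sum => i _; have [h1 h2] := h i.
rewrite -(fnorm_sqr L2H h1) -(fnorm_sqr L2H (hF i)) -exprMn.
rewrite lerXn2r ?nnegrE ?mulr_ge0//; first exact: (fnorm_ge0 L2H).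
exact: (fnorm_ge0 L2H (hF i)).
Qed.

Lemma L2vec_form_coercive a (b : R) F :
  {ae mu, forall x, Omega x -> b <= a x} ->
  fmem (F : L2vec Omega) -> fmem (mulv a F : L2vec Omega) ->
  b * fnorm (F : L2vec Omega) ^+ 2 <= L2vec_form Omega (mulv a F) F.
Proof.
move=> ab hF haF; rewrite (fnorm_sqr L2vecH)// /L2vec_form mulr_sumr.
apply: ler_sum => i _; rewrite coor_mulv; apply: L2form_coercive => //.
- exact: hF.
- by rewrite -coor_mulv; exact: haF.
Qed.

Lemma Linfty_rangeP (b c : R) a : 0 < b -> Linfty_range Omega b c a ->
  [/\ measurable_fun Omega a, {ae mu, forall x, Omega x -> b <= a x}
    & {ae mu, forall x, Omega x -> `|a x| <= c}].
Proof.
move=> b0 [ainf abc]; split.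
- apply/(measurable_restrictT _ mO).
  by move: ainf => /= /andP[]; rewrite !inE.
- by apply: filterS abc => x abc /abc /andP[].
- apply: filterS abc => x abc /abc /andP[bx xc].
  by rewrite ger0_norm// (le_trans (ltW b0)).
Qed.

Variables (b c : R) (a_ : nat -> 'rV[R]_n -> R) (a : 'rV[R]_n -> R).
Hypotheses (b0 : 0 < b) (ha_ : forall k, Linfty_range Omega b c (a_ k))
  (ha : Linfty_range Omega b c a).
Hypothesis acvg :
  @fnorm R (Lp mu Omega 1%E) (a_ k - a) @[k --> \oo] --> (0 : R).

(** The difference alpha_n - alpha is bounded by 2 c. It is integrable because
    Omega has finite measure; otherwise the real-valued L^1 norm could be the
    default value 0 of an infinite integral and its convergence would carry no
    information. *)
Lemma mulv_diff_cvg0 F : fmem (F : L2vec Omega) ->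
  fnorm (mulv (a_ k - a) F : L2vec Omega) @[k --> \oo] --> (0 : R).
Proof.
move=> hF; apply: (L2vec_cvg0 (Omega := Omega)) => i.
under eq_fun do rewrite coor_mulv.
have [ma _ ac] := Linfty_rangeP b0 ha.
have bound k : {ae mu, forall x, Omega x -> `|(a_ k - a) x| <= c + c}.
  have [_ _ akc] := Linfty_rangeP b0 (ha_ k).
  apply: filterS2 akc ac => x akc ac Ox.
  by apply: le_trans (ler_normB _ _) _; apply: lerD; [exact: akc|exact: ac].
apply: (@L2_multiplier_cvg0 _ _ _ mu _ mO (fun k => a_ k - a) (c + c)) => //.
- move=> k; have [mak _ _] := Linfty_rangeP b0 (ha_ k).
  apply: (@ae_integrable _ _ _ mu Omega mO _ (cst (c + c))) => //.
    exact: measurable_funB.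
  apply: measurable_bounded_integrable => //; first exact: leb_bounded_lty.
  by exists `|c + c|; split=> [|K /ltW cK x _ //]; exact: num_real.
- apply: cvg_trans acvg; apply: near_eq_cvg; apply: nearW => k.
  rewrite /= Lnorm1 Rintegral_mkcond /Rintegral; congr fine.
  apply: eq_integral => x _ /=; rewrite !patchE.
  by case: ifP => //=; rewrite normr0.
- exact: hF.
Qed.

(** alpha_n F_n - alpha F = alpha_n (F_n - F) + (alpha_n - alpha) F. *)
Lemma mulv_cvg (F_ : nat -> 'rV[R]_n -> 'rV[R]_n) F :
  (forall k, fmem (F_ k : L2vec Omega)) -> fmem (F : L2vec Omega) ->
  fnorm (F_ k - F : L2vec Omega) @[k --> \oo] --> (0 : R) ->
  fnorm (mulv (a_ k) (F_ k) - mulv a F : L2vec Omega) @[k --> \oo] --> (0 : R).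
Proof.
move=> hF_ hF cF; have := cvg_linear0 `|c| cF (mulv_diff_cvg0 hF).
have [ma _ ac] := Linfty_rangeP b0 ha.
apply: squeeze_norm0 => k; have [mak _ akc] := Linfty_rangeP b0 (ha_ k).
have hFF := fmemB L2vecH (hF_ k) hF.
have [h1 h1c] := mulv_L2vec mak akc hFF.
have [h2 _] := mulv_L2vec mak akc hF; have [h3 _] := mulv_L2vec ma ac hF.
have [h4 _] := mulv_L2vec mak akc (hF_ k).
have E : mulv (a_ k - a) F = mulv (a_ k) F - mulv a F.
  by apply/funext => x; rewrite /mulv !fctE scalerBl.
have h5 : fmem (mulv (a_ k - a) F : L2vec Omega).
  by rewrite E; exact: (fmemB L2vecH).
rewrite ger0_norm; last exact/(fnorm_ge0 L2vecH)/(fmemB L2vecH).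
rewrite (_ : _ - _ = mulv (a_ k) (F_ k - F) + mulv (a_ k - a) F).
  by apply: le_trans (fnormD L2vecH h1 h5) _; rewrite lerD2r.
rewrite E; apply/funext => x; rewrite /mulv !fctE scalerBr.
by rewrite addrA subrK.
Qed.

End coefficients.

(** * The Dirichlet problem *)

Section dirichlet.
Context (R : realType) (n : nat) (Omega : set 'rV[R]_n).
Hypotheses (mO : measurable Omega) (bO : bounded_set Omega).
Variables (b c : R) (b0 : 0 < b).
Local Notation mu := (leb R n).

Let L2H := L2_pre_hilbert mu mO.
Let L2vecH := L2vec_pre_hilbert mO.
Let H1H := H1_pre_hilbert mO bO.
Let H10H := H10_pre_hilbert mO bO.

Lemma grad_L2vec u : fmem (u : H1 Omega) -> fmem (grad u : L2vec Omega).
Proof. by case. Qed.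

Lemma gradDE (u v : sobolev R n) x : grad (u + v) x = grad u x + grad v x.
Proof. by []. Qed.

Lemma gradBE (u v : sobolev R n) x : grad (u - v) x = grad u x - grad v x.
Proof. by []. Qed.

Lemma H10_H1 u : fmem (u : H10 Omega) -> fmem (u : H1 Omega).
Proof. by case. Qed.

Lemma flux_L2vec a u : Linfty_range Omega b c a -> fmem (u : H1 Omega) ->
  fmem (flux a u : L2vec Omega).
Proof.
move=> /(Linfty_rangeP mO b0)[ma _ ac] hu.
by have [] := mulv_L2vec mO ma ac (grad_L2vec hu).
Qed.

(** The right-hand side of the equation is itself the divergence of a flux, so
    the equation says that the total flux is orthogonal to gradients of H^1_0. *)
Lemma dirichlet_orthogonal a u g v : Linfty_range Omega b c a ->
  fmem (g : H1 Omega) ->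
  dirichlet_solution Omega a (divergence Omega (flux a g)) u ->
  fmem (v : H10 Omega) -> L2vec_form Omega (flux a (u + g)) (grad v) = 0.
Proof.
move=> ha hg [/H10_H1 hu eq_u] hv; have := eq_u v hv.
have hfu := flux_L2vec ha hu; have hfg := flux_L2vec ha hg.
have hgv := grad_L2vec (H10_H1 hv).
rewrite /divergence (integral_edot mO hfu hgv) (integral_edot mO hfg hgv) opprK.
have -> : flux a (u + g) = flux a u + flux a g.
  by apply/funext => x; rewrite /flux gradDE fctE -scalerDr.
by rewrite (innerDl L2vecH)// => ->; rewrite addNr.
Qed.

Variables (a_ : nat -> 'rV[R]_n -> R) (a : 'rV[R]_n -> R).
Hypotheses (ha_ : forall k, Linfty_range Omega b c (a_ k))
  (ha : Linfty_range Omega b c a).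
Hypothesis acvg :
  @fnorm R (Lp mu Omega 1%E) (a_ k - a) @[k --> \oo] --> (0 : R).
Variables (g : sobolev R n) (u_ : nat -> sobolev R n) (u : sobolev R n).
Hypotheses (hg : fmem (g : H1 Omega))
  (hu_ : forall k,
    dirichlet_solution Omega (a_ k) (divergence Omega (flux (a_ k) g)) (u_ k))
  (hu : dirichlet_solution Omega a (divergence Omega (flux a g)) u).

Let hu_0 k : fmem (u_ k : H10 Omega). Proof. by case: (hu_ k). Qed.
Let hu0 : fmem (u : H10 Omega). Proof. by case: hu. Qed.
Let hw0 k : fmem (u_ k - u : H10 Omega).
Proof. exact: (fmemB H10H (hu_0 k) hu0). Qed.

(** Both equations are tested with u_n - u, and alpha_n grad (u_n + g) =
    alpha_n grad (u_n - u) + (alpha_n - alpha) grad (u + g) + alpha grad (u +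
    g). The last term is orthogonal to grad (u_n - u); coercivity on the left
    and Cauchy-Schwarz on the right leave one factor |grad (u_n - u)| to
    cancel. *)
Lemma dirichlet_energy_le k : b * fnorm (grad (u_ k - u) : L2vec Omega) <=
  fnorm (mulv (a_ k - a) (grad (u + g)) : L2vec Omega).
Proof.
have hw := grad_L2vec (H10_H1 (hw0 k)).
have hU : fmem (u + g : H1 Omega) by apply: (fmemD H1H) => //; exact: H10_H1.
have hd : fmem (mulv (a_ k - a) (grad (u + g)) : L2vec Omega).
  rewrite (_ : mulv _ _ = flux (a_ k) (u + g) - flux a (u + g)).
    by apply: (fmemB L2vecH); exact: flux_L2vec.
  by apply/funext => x; rewrite /mulv /flux !fctE scalerBl.
have hkw : fmem (flux (a_ k) (u_ k - u) : L2vec Omega).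
  exact: flux_L2vec (ha_ k) (H10_H1 (hw0 k)).
have eq0 := dirichlet_orthogonal ha hg hu (hw0 k).
have := dirichlet_orthogonal (ha_ k) hg (hu_ k) (hw0 k).
have -> : flux (a_ k) (u_ k + g) =
    flux (a_ k) (u_ k - u) + mulv (a_ k - a) (grad (u + g)) + flux a (u + g).
  apply/funext => x; rewrite /flux /mulv !fctE scalerBl -addrA subrK.
  by rewrite -scalerDr gradBE !gradDE addrA subrK.
rewrite (innerDl L2vecH)//; [|exact: (fmemD L2vecH)|exact: flux_L2vec].
rewrite eq0 addr0 (innerDl L2vecH)// => /eqP; rewrite addr_eq0 => /eqP energy.
have [_ ab _] := Linfty_rangeP mO b0 (ha_ k).
have := L2vec_form_coercive mO ab hw hkw; rewrite {}energy => coer.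
have := cauchy_schwarz L2vecH hd hw; rewrite ler_norml => /andP[cs _].
have := fnorm_ge0 L2vecH hw; rewrite le_eqVlt => /predU1P[<-|w0].
  by rewrite mulr0 (fnorm_ge0 L2vecH).
rewrite -(ler_pM2r w0); lra.
Qed.

Lemma dirichlet_grad_cvg :
  fnorm (grad (u_ k - u) : L2vec Omega) @[k --> \oo] --> (0 : R).
Proof.
have hU : fmem (u + g : H1 Omega) by apply: (fmemD H1H) => //; exact: H10_H1.
have d0 := mulv_diff_cvg0 mO bO b0 ha_ ha acvg (grad_L2vec hU).
have d1 : b^-1 * fnorm (mulv (a_ k - a) (grad (u + g)) : L2vec Omega)
    @[k --> \oo] --> (0 : R) by rewrite -(mulr0 b^-1); exact: cvgMr.
apply: (squeeze_norm0 _ d1) => k; have hw := grad_L2vec (H10_H1 (hw0 k)).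
rewrite ger0_norm ?(fnorm_ge0 L2vecH)// ler_pdivlMl//.
exact: dirichlet_energy_le.
Qed.

(** The index i is the direction in which the Poincare inequality is applied;
    having one amounts to the dimension being positive. *)
Lemma dirichlet_H1_cvg (i : 'I_n) :
  fnorm (u_ k - u : H10 Omega) @[k --> \oo] --> (0 : R).
Proof.
have [C wC] := poincare mO bO i.
have w0 := cvg_linear0 C dirichlet_grad_cvg dirichlet_grad_cvg.
apply: (squeeze_norm0 _ w0) => k.
rewrite ger0_norm; last exact: (fnorm_ge0 H10H (hw0 k)).
have [w1 w2 _] := H10_H1 (hw0 k).
have [_ _ h] := le_fnorm_H1 mO (conj w1 w2).
apply: (le_trans h); rewrite lerD2r; exact: (wC _ (hw0 k)).
Qed.

Let hu1 : fmem (u : H1 Omega) := H10_H1 hu0.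
Let hu_1 k : fmem (u_ k : H1 Omega) := H10_H1 (hu_0 k).

Lemma dirichlet_flux_cvg :
  fnorm (flux (a_ k) (u_ k) - flux a u : L2vec Omega) @[k --> \oo] --> (0 : R).
Proof.
exact: (mulv_cvg mO bO b0 ha_ ha acvg (fun k => grad_L2vec (hu_1 k))
  (grad_L2vec hu1) dirichlet_grad_cvg).
Qed.

Lemma energyE a' v : Linfty_range Omega b c a' -> fmem (v : H1 Omega) ->
  \int[mu]_(x in Omega) (a' x * enorm (grad v x) ^+ 2) =
  L2vec_form Omega (flux a' v) (grad v).
Proof.
move=> ha' hv.
rewrite -(integral_edot mO (flux_L2vec ha' hv) (grad_L2vec hv)).
apply: eq_Rintegral => x _; rewrite /enorm sqr_sqrtr; last first.
  by apply: sumr_ge0 => i _; rewrite -expr2 sqr_ge0.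
by rewrite /edot mulr_sumr; apply: eq_bigr => i _; rewrite mxE mulrA.
Qed.

Lemma dirichlet_energy_cvg :
  \int[mu]_(x in Omega) (a_ k x * enorm (grad (u_ k + g) x) ^+ 2)
    @[k --> \oo] -->
  \int[mu]_(x in Omega) (a x * enorm (grad (u + g) x) ^+ 2).
Proof.
have hU : fmem (u + g : H1 Omega) by exact: (fmemD H1H).
have hU_ k : fmem (u_ k + g : H1 Omega) by exact: (fmemD H1H).
rewrite (energyE ha hU).
under eq_fun => k do rewrite (energyE (ha_ k) (hU_ k)).
have gU k : grad (u_ k + g) - grad (u + g) = grad (u_ k - u).
  by apply/funext => x; rewrite gradBE !fctE !gradDE opprD addrACA subrr addr0.
have cU : fnorm (grad (u_ k + g) - grad (u + g) : L2vec Omega)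
    @[k --> \oo] --> (0 : R).
  under eq_fun do rewrite gU; exact: dirichlet_grad_cvg.
have cF := mulv_cvg mO bO b0 ha_ ha acvg (fun k => grad_L2vec (hU_ k))
  (grad_L2vec hU) cU.
exact: (inner_cvg L2vecH (fun k => flux_L2vec (ha_ k) (hU_ k))
  (fun k => grad_L2vec (hU_ k)) (flux_L2vec ha hU) (grad_L2vec hU) cF cU).
Qed.

End dirichlet.

Theorem proposition1 (R : realType) (N : nat) (hN : N = 2%N \/ N = 3%N)
    (Omega : set 'rV[R]_N) (hOmega : bounded_lipschitz_domain Omega)
    (b c : R) (hb : 0 < b) (hbc : b < c)
    (alpha_ : nat -> 'rV[R]_N -> R) (alpha : 'rV[R]_N -> R)
    (halpha_ : forall n, Linfty_range Omega b c (alpha_ n))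
    (halpha : Linfty_range Omega b c alpha)
    (hstrong :
      @fnorm R (Lp (leb R N) Omega 1%E) (alpha_ n - alpha) @[n --> \oo] -->
      (0 : R))
    (hweak : weak_star_cvg Omega alpha_ alpha)
    (gamma : H1 Omega -> Hhalf Omega) (hgamma : trace_operator gamma)
    (eta : Hhalf Omega -> H1 Omega) (heta : extension_operator gamma eta)
    (f : Hhalf Omega) (hf : fmem f)
    (u_ : nat -> H10 Omega)
    (hu_ : forall n, dirichlet_solution Omega (alpha_ n)
             (divergence Omega (flux (alpha_ n) (eta f))) (u_ n))
    (u : H10 Omega)
    (hu : dirichlet_solution Omega alpha
            (divergence Omega (flux alpha (eta f))) u) :
  [/\ weak_cvg u_ u,
      @weak_cvg R (L2vec Omega) (fun n => flux (alpha_ n) (u_ n)) (flux alpha u)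
    & \int[leb R N]_(x in Omega)
        (alpha_ n x * enorm (grad (u_ n + eta f) x) ^+ 2) @[n --> \oo] -->
      \int[leb R N]_(x in Omega)
        (alpha x * enorm (grad (u + eta f) x) ^+ 2)].
Proof.
have [_ oO _ bO _] := hOmega; have mO := open_measurable_rV oO.
have hg : fmem (eta f : H1 Omega).
  by have [[eta_mem _ _] _] := heta; exact: eta_mem.
have N0 : (0 < N)%N by case: hN => ->.
have hu0 : fmem u by case: hu.
have hu_0 k : fmem (u_ k) by case: (hu_ k).
split.
- apply: (strong_weak_cvg (H10_pre_hilbert mO bO)) => //.
  exact: (dirichlet_H1_cvg mO bO hb halpha_ halpha hstrong hg hu_ hu
    (Ordinal N0)).
- apply: (strong_weak_cvg (L2vec_pre_hilbert mO)).
  + by move=> k; exact: (flux_L2vec mO hb (halpha_ k) (H10_H1 (hu_0 k))).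
  + exact: (flux_L2vec mO hb halpha (H10_H1 hu0)).
  + exact: (dirichlet_flux_cvg mO bO hb halpha_ halpha hstrong hg hu_ hu).
- exact: (dirichlet_energy_cvg mO bO hb halpha_ halpha hstrong hg hu_ hu).
Qed.
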